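(* Let $d\ge 1$, $T>0$ and $\gamma>\frac d2$. Let $u$ be the solution on $[0,T]$ of the cubic nonlinear Schrödinger equation $$i\partial_t u+\Delta u+|u|^2u=0,\quad t>0,\ x\in\mathbb T^d,\qquad u(0,\cdot)=u_0,$$ where $u_0\in H^{\gamma+2}(\mathbb T^d)$ and $u\in L^\infty((0,T);H^{\gamma+2}(\mathbb T^d))$. For a step size $\tau>0$ define the numerical solution $u^n$ by $u^0=u_0$ and, for $n\ge 0$, $$u^{n+1}=\mathrm e^{i\tau\Delta}u^n+i\tau\,\mathrm e^{i\tau\Delta}\Big\{\big[\varphi(-2i\tau\Delta)+\psi(-2i\tau\Delta)\big]\overline{u^n}\cdot (u^n)^2\Big\}-i\tau\big[\mathrm e^{i\tau\Delta}\psi(-2i\tau\Delta)\overline{u^n}\big]\cdot\big(\mathrm e^{i\tau\Delta}u^n\big)^2-\frac{\tau^2}{2}\mathrm e^{i\tau\Delta}\big[|u^n|^4u^n\big].$$ Then there exist constants $\tau_0,C>0$, depending only on $T$ and $\|u\|_{L^\infty((0,T);H^{\gamma+2}(\mathbb T^d))}$, such that for all $0<\tau\le\tau_0$, $$\|u(t_n,\cdot)-u^n\|_{H^\gamma(\mathbb T^d)}\le C\tau^2\qquad\text{for all } n\ge 0 \text{ with } 0\le n\tau\le T,$$ where $t_n=n\tau$.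
   Context: $\mathbb T=(0,2\pi)$ with periodic boundary conditions. The functions $\varphi,\psi$ are $\varphi(z)=\frac{e^z-1}{z}$ for $z\neq0$, $\varphi(0)=1$, and $\psi(z)=\frac{e^z-1-ze^z}{z^2}$ for $z\ne0$, $\psi(0)=-\frac12$. For such a function $f$, the operator $f(-2i\tau\Delta)$ is the Fourier multiplier acting on the Fourier coefficient at $\boldsymbol\xi\in\mathbb Z^d$ by multiplication with $f(2i\tau|\boldsymbol\xi|^2)$; likewise $\mathrm e^{it\Delta}$ multiplies the $\boldsymbol\xi$-th Fourier coefficient by $\mathrm e^{-it|\boldsymbol\xi|^2}$. $H^s(\mathbb T^d)$ is the Sobolev space with norm $\|f\|_{H^s}=\|(1-\Delta)^{s/2}f\|_{L^2}$. *)

(* Defs.v *)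
From Stdlib Require Import Reals List ZArith.
From Coquelicot Require Import Coquelicot.

(* Functions on T^d = (0,2pi)^d (periodic) are represented by their Fourier
   coefficients  f^(xi) = (2pi)^(-d) int_{T^d} f(x) e^{-i xi.x} dx,
   indexed by frequencies xi in Z^d, encoded as lists of integers of length d.
   Values at lists of other lengths are irrelevant junk and never used. *)
Definition Four := list Z -> C.

Open Scope R_scope.

Definition Cexp (z : C) : C := (exp (fst z) * cos (snd z), exp (fst z) * sin (snd z)).
Definition Ci : C := (0, 1).

Definition Cis0 (z : C) : bool :=
  if Req_EM_T (fst z) 0 then (if Req_EM_T (snd z) 0 then true else false) else false.

Definition phi (z : C) : C :=
  if Cis0 z then RtoC 1 else ((Cexp z - RtoC 1) / z)%C.
Definition psi (z : C) : C :=
  if Cis0 z then RtoC (-1/2) else ((Cexp z - RtoC 1 - z * Cexp z) / (z * z))%C.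

Definition nrm2 (xi : list Z) : R := IZR (fold_right (fun k acc => (k * k + acc)%Z) 0%Z xi).
Definition vsub (xi eta : list Z) : list Z := map (fun p => (fst p - snd p)%Z) (combine xi eta).
Definition vneg (xi : list Z) : list Z := map Z.opp xi.

Definition zrange (N : nat) : list Z :=
  map (fun k => (Z.of_nat k - Z.of_nat N)%Z) (seq 0 (2 * N + 1)).
Fixpoint box (d N : nat) : list (list Z) :=
  match d with
  | O => nil :: nil
  | S d' => flat_map (fun k => map (cons k) (box d' N)) (zrange N)
  end.

Definition Clsum (l : list (list Z)) (f : list Z -> C) : C :=
  fold_right (fun x acc => (f x + acc)%C) (RtoC 0) l.
Definition Rlsum (l : list (list Z)) (f : list Z -> R) : R :=
  fold_right (fun x acc => f x + acc) 0 l.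

(* sum over Z^d, as limit of cube partial sums (equal to the absolute sum
   for all absolutely summable families, which is the case for every family
   arising in the theorem) *)
Definition zsum (d : nat) (f : list Z -> C) : C :=
  (real (Lim_seq (fun N => fst (Clsum (box d N) f))),
   real (Lim_seq (fun N => snd (Clsum (box d N) f)))).

(* Fourier side of the pointwise product: convolution *)
Definition conv (d : nat) (a b : Four) : Four :=
  fun xi => zsum d (fun eta => (a eta * b (vsub xi eta))%C).
(* Fourier coefficients of the complex conjugate function *)
Definition conjF (a : Four) : Four := fun xi => Cconj (a (vneg xi)).
Definition mult (m : list Z -> C) (a : Four) : Four := fun xi => (m xi * a xi)%C.
Definition Fsub (a b : Four) : Four := fun xi => (a xi - b xi)%C.

Definition Hnorm (d : nat) (s : R) (a : Four) : Rbar :=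
  match Lim_seq (fun N => Rlsum (box d N)
          (fun xi => (2 * PI) ^ d * Rpower (1 + nrm2 xi) s * (Cmod (a xi)) ^ 2)) with
  | Finite r => Finite (sqrt r)
  | p_infty => p_infty
  | m_infty => m_infty
  end.

(* e^{i t Delta} : multiplication of the xi-th coefficient by e^{-i t |xi|^2} *)
Definition Sch (t : R) (xi : list Z) : C := Cexp (- (Ci * RtoC (t * nrm2 xi)))%C.

Definition cubic (d : nat) (a : Four) : Four := conv d (conjF a) (conv d a a).
Definition quintic (d : nat) (a : Four) : Four :=
  conv d (conjF a) (conv d (conjF a) (conv d a (conv d a a))).

(* u solves i u_t + Delta u + |u|^2 u = 0 on [0,T], u(0) = u0, in the
   (Fourier-coefficientwise) Duhamel sense:
   u^(t,xi) = e^{-it|xi|^2} u0^(xi) + i int_0^t e^{-i(t-s)|xi|^2} (|u|^2u)^(s,xi) ds *)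
Definition nls_solution (d : nat) (T : R) (u0 : Four) (u : R -> Four) : Prop :=
  forall xi : list Z, length xi = d ->
    u 0 xi = u0 xi /\
    forall t, 0 <= t <= T ->
      is_RInt (fun s => (Ci * Sch (t - s) xi * cubic d (u s) xi)%C) 0 t
              (u t xi - Sch t xi * u0 xi)%C.

(* f(-2 i tau Delta) multiplies the xi-th coefficient by f(2 i tau |xi|^2) *)
Definition mphi (tau : R) (xi : list Z) : C := phi (Ci * RtoC (2 * tau * nrm2 xi))%C.
Definition mpsi (tau : R) (xi : list Z) : C := psi (Ci * RtoC (2 * tau * nrm2 xi))%C.

Definition step (d : nat) (tau : R) (a : Four) : Four := fun xi =>
  (Sch tau xi * a xi
   + Ci * RtoC tau * Sch tau xi
       * conv d (mult (fun k => mphi tau k + mpsi tau k)%C (conjF a)) (conv d a a) xi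
   - Ci * RtoC tau
       * conv d (mult (fun k => Sch tau k * mpsi tau k)%C (conjF a))
                (conv d (mult (Sch tau) a) (mult (Sch tau) a)) xi
   - RtoC (tau ^ 2 / 2) * Sch tau xi * quintic d a xi)%C.

Definition numsol (d : nat) (tau : R) (u0 : Four) (n : nat) : Four :=
  Nat.iter n (step d tau) u0.

(* Main.v *)
From Stdlib Require Import Reals List ZArith Lia Lra Psatz FinFun.
From Coquelicot Require Import Coquelicot.
(* Imported last: [mult] and [Ci] must shadow Coquelicot's constants of the same names. *)
Require Import Defs.
Open Scope R_scope.

(** In the interaction picture [v(s) = e^{-is Delta} u(t_n + s)] the flow over one step is
    [v(tau) - v(0) = i int_0^tau N_s(v(s)) ds], where the Fourier symbol of the cubic form [N_s]
    is [e^{is(2|y|^2 + b)}] with [y] the frequency of the conjugated factor and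
    [b = 2(y.z + y.q + z.q)].  The scheme integrates [e^{2is|y|^2}] exactly and interpolates
    [e^{isb}] linearly between [s = 0] and [s = tau]; the interpolation error is
    [O(tau^2 b^2)], and [b^2] costs at most two derivatives on each factor, so it is
    [O(tau^2)] in [H^gamma].  Since [v] is Lipschitz in [H^{gamma+2}] and freezing each free
    flow costs one power of time and two derivatives,
    [N_s(v(s)) = N_s(v(0)) + i s |v(0)|^4 v(0) + O(s^2)] in [H^gamma], which produces the
    quintic correction.  Hence the local error is [O(tau^3)].  The scheme is Lipschitz with
    constant [1 + O(tau)] on bounded sets of [H^gamma], an algebra for [gamma > d/2], and a
    discrete Gronwall argument concludes. *)

(** * Finite sums *)

(** Two obstacles shape the argument. First, [zsum] is a total operator built from [Lim_seq], so
    linearity, reindexing and exchange of sums hold only under absolute summability. Summability is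
    therefore carried along with the norm bounds, and norms enter through the predicate [Hb], a
    uniform bound on all finite box sums, which is stable under limits. Second, a solution is given
    coefficient by coefficient through Duhamel's formula, without continuity in time with values in
    a Sobolev space. Hence every identity in time is one between scalar integrals, and norms of
    integrals are estimated by duality on finite boxes.

    The local estimates see the solution only through its bound [M] in the upper norm, but stability
    also requires a bound on the numerical solution. It is regained at every step from the error
    estimate itself, and this is what fixes [tau0].

    The unit of loss is the factor [1 + nrm2 x], worth two derivatives: freezing a flow costs one
    such factor, the interpolation error one in each of its three slots. *)

Lemma Rlsum_ext l f g : (forall x, In x l -> f x = g x) -> Rlsum l f = Rlsum l g.
Proof.
  induction l as [|a l IH]; simpl; intros H; [reflexivity|].
  rewrite H, IH; auto.
Qed.

Lemma Rlsum_le l f g : (forall x, In x l -> f x <= g x) -> Rlsum l f <= Rlsum l g.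
Proof.
  induction l as [|a l IH]; simpl; intros H; [lra|].
  apply Rplus_le_compat; auto.
Qed.

Lemma Rlsum_plus l f g : Rlsum l (fun x => f x + g x) = Rlsum l f + Rlsum l g.
Proof. induction l as [|a l IH]; simpl; [|rewrite IH]; ring. Qed.

Lemma Rlsum_scal l c f : Rlsum l (fun x => c * f x) = c * Rlsum l f.
Proof. induction l as [|a l IH]; simpl; [|rewrite IH]; ring. Qed.

Lemma Rlsum_minus l f g : Rlsum l (fun x => f x - g x) = Rlsum l f - Rlsum l g.
Proof. induction l as [|a l IH]; simpl; [|rewrite IH]; ring. Qed.

Lemma Rlsum_ge0 l f : (forall x, In x l -> 0 <= f x) -> 0 <= Rlsum l f.
Proof.
  induction l as [|a l IH]; simpl; intros H; [lra|].
  apply Rplus_le_le_0_compat; auto.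
Qed.

Lemma Rlsum_map s l f : Rlsum (map s l) f = Rlsum l (fun x => f (s x)).
Proof. induction l as [|a l IH]; simpl; [|rewrite IH]; reflexivity. Qed.

Lemma Rlsum_app l m f : Rlsum (l ++ m) f = Rlsum l f + Rlsum m f.
Proof. induction l as [|a l IH]; simpl; [|rewrite IH]; ring. Qed.

Lemma Rlsum_abs l f : Rabs (Rlsum l f) <= Rlsum l (fun x => Rabs (f x)).
Proof.
  induction l as [|a l IH]; simpl; [rewrite Rabs_R0; lra|].
  eapply Rle_trans; [apply Rabs_triang|]; lra.
Qed.

(** Each element of [l] uses up one occurrence in [m]. This compares partial sums over sets of
    different shapes, such as a box and the image of a box. *)
Lemma Rlsum_incl l m f :
  NoDup l -> incl l m -> (forall x, In x m -> 0 <= f x) -> Rlsum l f <= Rlsum m f.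
Proof.
  revert m; induction l as [|a l IH]; intros m Hn Hi Hp; simpl.
  - now apply Rlsum_ge0.
  - inversion Hn as [|? ? Ha Hl]; subst.
    destruct (in_split a m) as [m1 [m2 ->]]; [apply Hi; now left|].
    rewrite Rlsum_app; simpl.
    assert (Rlsum l f <= Rlsum (m1 ++ m2) f).
    { apply IH; auto.
      - intros x Hx. assert (In x (m1 ++ a :: m2)) as H by (apply Hi; now right).
        apply in_app_or in H. apply in_or_app. simpl in H.
        destruct H as [H|[H|H]]; auto. subst; contradiction.
      - intros x Hx. apply Hp. apply in_app_or in Hx. apply in_or_app. simpl. tauto. }
    rewrite Rlsum_app in H. lra.
Qed.

Lemma Rlsum_swap l m f :
  Rlsum l (fun x => Rlsum m (fun y => f x y)) = Rlsum m (fun y => Rlsum l (fun x => f x y)).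
Proof.
  induction l as [|a l IH]; simpl.
  - induction m as [|b m IHm]; simpl; [|rewrite <- IHm]; ring.
  - rewrite IH, <- Rlsum_plus; reflexivity.
Qed.

(** Induction step of Cauchy-Schwarz, with [S] the inner product of the tails; the cross terms are
    absorbed by the square of [|x| sqrt B - |y| sqrt A]. It serves both for weighted sums and for
    integer vectors. *)
Lemma CS_step (S A B x y : R) :
  S ^ 2 <= A * B -> 0 <= A -> 0 <= B -> (x * y + S) ^ 2 <= (x ^ 2 + A) * (y ^ 2 + B).
Proof.
  intros HS HA HB.
  assert (HS' : Rabs S <= sqrt A * sqrt B).
  { rewrite <- sqrt_mult by assumption. rewrite <- (sqrt_Rsqr_abs S).
    apply sqrt_le_1_alt. unfold Rsqr. nra. }
  assert (exists p, 0 <= p /\ p * p = A /\ p = sqrt A) as [p [Hp [HpA Hps]]]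
    by (exists (sqrt A); repeat split; [apply sqrt_pos|now apply sqrt_sqrt]).
  assert (exists q, 0 <= q /\ q * q = B /\ q = sqrt B) as [q [Hq [HqB Hqs]]]
    by (exists (sqrt B); repeat split; [apply sqrt_pos|now apply sqrt_sqrt]).
  rewrite <- Hps, <- Hqs in HS'. clear Hps Hqs. subst A B.
  assert (x * y * S <= Rabs (x * y) * (p * q)).
  { eapply Rle_trans; [apply Rle_abs|]. rewrite Rabs_mult.
    apply Rmult_le_compat_l; [apply Rabs_pos|]. exact HS'. }
  assert (2 * (Rabs (x * y) * (p * q)) <= x ^ 2 * (q * q) + y ^ 2 * (p * p)).
  { rewrite Rabs_mult.
    pose proof (pow2_ge_0 (Rabs x * q - Rabs y * p)).
    rewrite <- (pow2_abs x), <- (pow2_abs y). nra. }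
  nra.
Qed.

Lemma Rlsum_CS l f g :
  (Rlsum l (fun x => f x * g x)) ^ 2
    <= Rlsum l (fun x => f x ^ 2) * Rlsum l (fun x => g x ^ 2).
Proof.
  induction l as [|a l IH]; [simpl; lra|].
  apply (CS_step _ _ _ (f a) (g a) IH); apply Rlsum_ge0; intros; apply pow2_ge_0.
Qed.

Lemma Clsum_fst l f : fst (Clsum l f) = Rlsum l (fun x => fst (f x)).
Proof. induction l as [|a l IH]; simpl; [|rewrite IH]; reflexivity. Qed.

Lemma Clsum_snd l f : snd (Clsum l f) = Rlsum l (fun x => snd (f x)).
Proof. induction l as [|a l IH]; simpl; [|rewrite IH]; reflexivity. Qed.

Lemma Cmod_Clsum l f : Cmod (Clsum l f) <= Rlsum l (fun x => Cmod (f x)).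
Proof.
  induction l as [|a l IH]; simpl; [rewrite Cmod_0; lra|].
  eapply Rle_trans; [apply Cmod_triangle|]; lra.
Qed.

(** * Boxes *)

Lemma in_zrange k N : In k (zrange N) <-> (- Z.of_nat N <= k <= Z.of_nat N)%Z.
Proof.
  unfold zrange. rewrite in_map_iff. split.
  - intros [n [<- Hn]]. apply in_seq in Hn. lia.
  - intros H. exists (Z.to_nat (k + Z.of_nat N)). rewrite in_seq. lia.
Qed.

Lemma NoDup_zrange N : NoDup (zrange N).
Proof.
  apply Injective_map_NoDup; [|apply seq_NoDup]. intros x y H. lia.
Qed.

Lemma in_box d N x :
  In x (box d N) <-> length x = d /\ List.Forall (fun k => - Z.of_nat N <= k <= Z.of_nat N)%Z x.
Proof.
  revert x; induction d as [|d IH]; intros x; simpl.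
  - split.
    + intros [<-|[]]; auto.
    + destruct x; simpl; [auto|intros [H _]; discriminate].
  - rewrite in_flat_map. split.
    + intros [k [Hk Hx]]. apply in_map_iff in Hx. destruct Hx as [y [<- Hy]].
      apply IH in Hy. apply in_zrange in Hk. destruct Hy as [Hl Hf].
      split; [simpl; now rewrite Hl|now constructor].
    + intros [Hl Hf]. destruct x as [|k y]; [discriminate|].
      inversion Hf; subst. exists k. split; [now apply in_zrange|].
      apply in_map, IH. split; [now injection Hl|assumption].
Qed.

Lemma box_length d N x : In x (box d N) -> length x = d.
Proof. rewrite in_box; tauto. Qed.

Lemma NoDup_flat_map (A B : Type) (f : A -> list B) l :
  NoDup l -> (forall x, NoDup (f x)) ->
  (forall x y z, In z (f x) -> In z (f y) -> x = y) -> NoDup (flat_map f l).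
Proof.
  intros Hl Hf Hd. induction Hl as [|a l Ha Hl IH]; simpl; [constructor|].
  apply NoDup_app; auto.
  intros z Hz Hz'. apply in_flat_map in Hz'. destruct Hz' as [y [Hy Hz']].
  rewrite (Hd a y z) in Ha by assumption. contradiction.
Qed.

Lemma NoDup_box d N : NoDup (box d N).
Proof.
  induction d as [|d IH]; simpl.
  - repeat constructor; simpl; tauto.
  - apply NoDup_flat_map; [apply NoDup_zrange| |].
    + intros k. apply Injective_map_NoDup; [|assumption]. congruence.
    + intros k k' z H H'. apply in_map_iff in H. apply in_map_iff in H'.
      destruct H as [? [<- _]], H' as [? [H _]]. congruence.
Qed.

Lemma box_incl d N M : (N <= M)%nat -> incl (box d N) (box d M).
Proof.
  intros H x. rewrite !in_box. intros [Hl Hf]. split; [assumption|].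
  eapply Forall_impl; [|exact Hf]. simpl. lia.
Qed.

Lemma in_some_box d x : length x = d -> exists N, In x (box d N).
Proof.
  intros Hl. enough (exists N, List.Forall (fun k => - Z.of_nat N <= k <= Z.of_nat N)%Z x) as [N H].
  { exists N. apply in_box; auto. }
  clear. induction x as [|k x [N IH]]; [exists 0%nat; constructor|].
  exists (N + Z.to_nat (Z.abs k))%nat. constructor; [lia|].
  eapply Forall_impl; [|exact IH]. simpl. lia.
Qed.

Lemma incl_some_box d L : (forall x, In x L -> length x = d) -> exists N, incl L (box d N).
Proof.
  induction L as [|a L IH]; intros H; [exists 0%nat; intros ? []|].
  destruct IH as [N HN]; [intros; apply H; now right|].
  destruct (in_some_box d a) as [M HM]; [apply H; now left|].
  exists (N + M)%nat. intros x [<-|Hx].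
  - eapply box_incl; [|exact HM]; lia.
  - eapply box_incl; [|apply HN, Hx]; lia.
Qed.

(** * Sums of real families over the lattice *)

(** The real counterpart of [zsum]. It too is total, with [real] sending infinite limits to 0, so
    its algebraic laws are proved under [summable]. *)
Definition Rzsum (d : nat) (f : list Z -> R) : R :=
  real (Lim_seq (fun N => Rlsum (box d N) f)).

Definition summable (d : nat) (f : list Z -> R) : Prop :=
  exists B, forall N, Rlsum (box d N) (fun x => Rabs (f x)) <= B.

Lemma Rlsum_box_mono d f N M :
  (forall x, length x = d -> 0 <= f x) -> (N <= M)%nat ->
  Rlsum (box d N) f <= Rlsum (box d M) f.
Proof.
  intros Hf H. apply Rlsum_incl; [apply NoDup_box|now apply box_incl|].
  intros x Hx. apply Hf. now apply box_length in Hx.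
Qed.

(** Boxes exhaust the lattice, so for nonnegative terms a bound along boxes is a bound over all
    finite sets. This makes the sums independent of the order of exhaustion. *)
Lemma Rlsum_le_of_box d f L B :
  (forall x, length x = d -> 0 <= f x) -> (forall N, Rlsum (box d N) f <= B) ->
  NoDup L -> (forall x, In x L -> length x = d) -> Rlsum L f <= B.
Proof.
  intros Hf HB HL Hd. destruct (incl_some_box d L Hd) as [N HN].
  eapply Rle_trans; [|apply (HB N)]. apply Rlsum_incl; auto.
  intros x Hx. apply Hf. now apply box_length in Hx.
Qed.

Lemma summable_le d f g :
  (forall x, length x = d -> Rabs (f x) <= Rabs (g x)) -> summable d g -> summable d f.
Proof.
  intros H [B HB]. exists B. intros N. eapply Rle_trans; [|apply (HB N)].
  apply Rlsum_le. intros x Hx. apply H. now apply box_length in Hx.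
Qed.

Lemma summable_abs d f : summable d f -> summable d (fun x => Rabs (f x)).
Proof. apply summable_le. intros. rewrite Rabs_Rabsolu. lra. Qed.

Lemma summable_plus d f g :
  summable d f -> summable d g -> summable d (fun x => f x + g x).
Proof.
  intros [A HA] [B HB]. exists (A + B). intros N.
  eapply Rle_trans; [|apply Rplus_le_compat; [apply (HA N)|apply (HB N)]].
  rewrite <- Rlsum_plus. apply Rlsum_le. intros. apply Rabs_triang.
Qed.

Lemma summable_scal d c f : summable d f -> summable d (fun x => c * f x).
Proof.
  intros [A HA]. exists (Rabs c * A). intros N.
  rewrite (Rlsum_ext _ _ (fun x => Rabs c * Rabs (f x))) by (intros; apply Rabs_mult).
  rewrite Rlsum_scal. apply Rmult_le_compat_l; [apply Rabs_pos|apply HA].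
Qed.

Lemma Rzsum_lim_pos d f :
  (forall x, length x = d -> 0 <= f x) -> summable d f ->
  is_lim_seq (fun N => Rlsum (box d N) f) (Rzsum d f).
Proof.
  intros Hf [B HB]. unfold Rzsum. apply Lim_seq_correct'.
  apply ex_finite_lim_seq_incr with B.
  - intros n. apply Rlsum_box_mono; auto.
  - intros n. eapply Rle_trans; [|apply (HB n)]. apply Rlsum_le. intros. apply Rle_abs.
Qed.

Lemma Rzsum_unique d f (l : R) :
  is_lim_seq (fun N => Rlsum (box d N) f) l -> Rzsum d f = l.
Proof. intros H. unfold Rzsum. now rewrite (is_lim_seq_unique _ _ H). Qed.

(** The splitting [f = (f + |f|) - |f|] reduces the claim to two families with monotone partial
    sums. *)
Lemma Rzsum_lim d f :
  summable d f -> is_lim_seq (fun N => Rlsum (box d N) f) (Rzsum d f).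
Proof.
  intros Hf.
  assert (H1 : summable d (fun x => f x + Rabs (f x)))
    by (apply summable_plus; [assumption|now apply summable_abs]).
  assert (L1 := Rzsum_lim_pos d (fun x => f x + Rabs (f x))
    ltac:(intros; pose proof (Rle_abs (- f x)); rewrite Rabs_Ropp in *; lra) H1).
  assert (L2 := Rzsum_lim_pos d (fun x => Rabs (f x)) ltac:(intros; apply Rabs_pos)
    (summable_abs _ _ Hf)).
  assert (L : is_lim_seq (fun N => Rlsum (box d N) f)
    (Rzsum d (fun x => f x + Rabs (f x)) - Rzsum d (fun x => Rabs (f x)))).
  { eapply is_lim_seq_ext; [|apply (is_lim_seq_minus' _ _ _ _ L1 L2)].
    intros n; simpl. rewrite Rlsum_plus. ring. }
  now rewrite (Rzsum_unique _ _ _ L).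
Qed.

Lemma Rzsum_ext d f g :
  (forall x, length x = d -> f x = g x) -> Rzsum d f = Rzsum d g.
Proof.
  intros H. unfold Rzsum. f_equal. apply Lim_seq_ext. intros n.
  apply Rlsum_ext. intros x Hx. apply H. now apply box_length in Hx.
Qed.

Lemma Rzsum_plus d f g :
  summable d f -> summable d g -> Rzsum d (fun x => f x + g x) = Rzsum d f + Rzsum d g.
Proof.
  intros Hf Hg. apply Rzsum_unique.
  eapply is_lim_seq_ext; [|apply is_lim_seq_plus'; apply Rzsum_lim; eassumption].
  intros n. symmetry. apply Rlsum_plus.
Qed.

Lemma Rzsum_scal d c f : summable d f -> Rzsum d (fun x => c * f x) = c * Rzsum d f.
Proof.
  intros Hf. apply Rzsum_unique.
  eapply is_lim_seq_ext; [|apply (is_lim_seq_scal_l _ c _ (Rzsum_lim d f Hf))].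
  intros n. symmetry. apply Rlsum_scal.
Qed.

Lemma Rzsum_minus d f g :
  summable d f -> summable d g -> Rzsum d (fun x => f x - g x) = Rzsum d f - Rzsum d g.
Proof.
  intros Hf Hg. apply Rzsum_unique.
  eapply is_lim_seq_ext; [|apply is_lim_seq_minus'; apply Rzsum_lim; eassumption].
  intros n. symmetry. apply Rlsum_minus.
Qed.

Lemma Rzsum_le_bound d f B :
  summable d f -> (forall N, Rlsum (box d N) f <= B) -> Rzsum d f <= B.
Proof.
  intros Hf HB.
  exact (is_lim_seq_le _ _ _ _ HB (Rzsum_lim d f Hf) (is_lim_seq_const B)).
Qed.

Lemma Rlsum_box_le_Rzsum d f N :
  (forall x, length x = d -> 0 <= f x) -> summable d f ->
  Rlsum (box d N) f <= Rzsum d f.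
Proof.
  intros Hp Hf. apply (is_lim_seq_incr_compare _ _ (Rzsum_lim d f Hf)).
  intros n. apply Rlsum_box_mono; auto.
Qed.

Lemma Rlsum_le_Rzsum d f L :
  (forall x, length x = d -> 0 <= f x) -> summable d f ->
  NoDup L -> (forall x, In x L -> length x = d) -> Rlsum L f <= Rzsum d f.
Proof.
  intros Hp Hf HL Hd. apply Rlsum_le_of_box with d; auto.
  intros N. now apply Rlsum_box_le_Rzsum.
Qed.

(** Partial sums of the nonnegative families [g + f] and [g - f] stay below their totals; the two
    inequalities together bound the tail of [f]. The bound depends on [g] alone, hence is uniform
    over dominated families. *)
Lemma Rzsum_tail d f g N :
  (forall x, length x = d -> Rabs (f x) <= g x) -> summable d g ->
  Rabs (Rzsum d f - Rlsum (box d N) f) <= Rzsum d g - Rlsum (box d N) g.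
Proof.
  intros H Hg.
  assert (Hf : summable d f).
  { revert Hg. apply summable_le. intros x Hx. eapply Rle_trans; [now apply H|apply Rle_abs]. }
  assert (H1 : Rlsum (box d N) (fun x => g x + f x) <= Rzsum d (fun x => g x + f x)).
  { apply Rlsum_box_le_Rzsum; [|now apply summable_plus].
    intros x Hx. specialize (H x Hx). apply Rabs_le_between in H. lra. }
  assert (H2 : Rlsum (box d N) (fun x => g x + -1 * f x) <= Rzsum d (fun x => g x + -1 * f x)).
  { apply Rlsum_box_le_Rzsum; [|apply summable_plus; [|apply summable_scal]; assumption].
    intros x Hx. specialize (H x Hx). apply Rabs_le_between in H. lra. }
  rewrite !Rlsum_plus, !Rlsum_scal, !Rzsum_plus, ?Rzsum_scal in * by
    (try apply summable_scal; assumption).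
  apply Rabs_le. lra.
Qed.

Lemma summable_reindex d s f :
  (forall x, length x = d -> length (s x) = d) ->
  (forall x y, length x = d -> length y = d -> s x = s y -> x = y) ->
  summable d f -> summable d (fun x => f (s x)).
Proof.
  intros Hs Hi [B HB]. exists B. intros N.
  rewrite <- (Rlsum_map s _ (fun x => Rabs (f x))).
  apply Rlsum_le_of_box with d; auto; [intros; apply Rabs_pos| |].
  - apply NoDup_map_NoDup_ForallPairs; [|apply NoDup_box].
    intros x y Hx Hy. apply Hi; eapply box_length; eassumption.
  - intros x Hx. apply in_map_iff in Hx. destruct Hx as [y [<- Hy]].
    apply Hs. eapply box_length; eassumption.
Qed.

Lemma Rzsum_reindex_le d s f :
  (forall x, length x = d -> length (s x) = d) ->
  (forall x y, length x = d -> length y = d -> s x = s y -> x = y) ->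
  (forall x, length x = d -> 0 <= f x) ->
  summable d f -> Rzsum d (fun x => f (s x)) <= Rzsum d f.
Proof.
  intros Hs Hi Hp Hf. apply Rzsum_le_bound; [now apply summable_reindex|].
  intros N. rewrite <- (Rlsum_map s). apply Rlsum_le_Rzsum; auto.
  - apply NoDup_map_NoDup_ForallPairs; [|apply NoDup_box].
    intros x y Hx Hy. apply Hi; eapply box_length; eassumption.
  - intros x Hx. apply in_map_iff in Hx. destruct Hx as [y [<- Hy]].
    apply Hs. eapply box_length; eassumption.
Qed.

(* All the reindexings needed are involutions. *)
Lemma Rzsum_reindex d s f :
  (forall x, length x = d -> length (s x) = d) ->
  (forall x, length x = d -> s (s x) = x) ->
  summable d f -> Rzsum d (fun x => f (s x)) = Rzsum d f.
Proof.
  intros Hs Hss.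
  assert (Hi : forall x y, length x = d -> length y = d -> s x = s y -> x = y).
  { intros x y Hx Hy H. rewrite <- (Hss x Hx), <- (Hss y Hy). now f_equal. }
  assert (P : forall g, (forall x, length x = d -> 0 <= g x) -> summable d g ->
    Rzsum d (fun x => g (s x)) = Rzsum d g).
  { intros g Hp Hg. apply Rle_antisym; [now apply Rzsum_reindex_le|].
    rewrite (Rzsum_ext d g (fun x => g (s (s x)))) by (intros; now rewrite Hss).
    apply (Rzsum_reindex_le d s (fun x => g (s x))); auto.
    now apply summable_reindex. }
  intros Hf.
  assert (H1 : summable d (fun x => f x + Rabs (f x)))
    by (apply summable_plus; [assumption|now apply summable_abs]).
  assert (E1 := P (fun x => f x + Rabs (f x))
    ltac:(intros; pose proof (Rle_abs (- f x)); rewrite Rabs_Ropp in *; lra) H1).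
  assert (E2 := P (fun x => Rabs (f x)) ltac:(intros; apply Rabs_pos) (summable_abs _ _ Hf)).
  cbv beta in E1, E2.
  assert (Hfs := summable_reindex d s f Hs Hi Hf).
  rewrite (Rzsum_plus d (fun x => f (s x)) (fun x => Rabs (f (s x)))) in E1
    by (try apply (summable_abs d (fun x => f (s x))); assumption).
  rewrite (Rzsum_plus d f (fun x => Rabs (f x))) in E1
    by (try apply summable_abs; assumption).
  lra.
Qed.

(** * Double sums over the lattice *)

Definition summable2 (d : nat) (f : list Z -> list Z -> R) : Prop :=
  exists B, forall N M,
    Rlsum (box d N) (fun x => Rlsum (box d M) (fun y => Rabs (f x y))) <= B.

Lemma summable2_swap d f : summable2 d f -> summable2 d (fun y x => f x y).
Proof. intros [B HB]. exists B. intros N M. rewrite Rlsum_swap. apply HB. Qed.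

Lemma summable2_inner d f x : summable2 d f -> length x = d -> summable d (f x).
Proof.
  intros [B HB] Hx. exists B. intros M. destruct (in_some_box d x Hx) as [N HN].
  eapply Rle_trans; [|apply (HB N M)].
  set (g := fun x => Rlsum (box d M) (fun y => Rabs (f x y))).
  replace (Rlsum (box d M) (fun y => Rabs (f x y))) with (Rlsum (x :: nil) g)
    by (simpl; unfold g; ring).
  apply Rlsum_incl.
  - repeat constructor; simpl; tauto.
  - intros y [<-|[]]; assumption.
  - intros y _. apply Rlsum_ge0. intros. apply Rabs_pos.
Qed.

Lemma is_lim_seq_Rlsum l (u : nat -> list Z -> R) (v : list Z -> R) :
  (forall x, In x l -> is_lim_seq (fun n => u n x) (v x)) ->
  is_lim_seq (fun n => Rlsum l (u n)) (Rlsum l v).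
Proof.
  induction l as [|a l IH]; intros H; simpl; [apply is_lim_seq_const|].
  apply is_lim_seq_plus'; [apply H; now left|]. apply IH. intros; apply H; now right.
Qed.

Lemma Rzsum2_abs_le d f B :
  (forall N M, Rlsum (box d N) (fun x => Rlsum (box d M) (fun y => Rabs (f x y))) <= B) ->
  forall N, Rlsum (box d N) (fun x => Rzsum d (fun y => Rabs (f x y))) <= B.
Proof.
  intros HB N.
  assert (L : is_lim_seq (fun M => Rlsum (box d N) (fun x => Rlsum (box d M) (fun y => Rabs (f x y))))
    (Rlsum (box d N) (fun x => Rzsum d (fun y => Rabs (f x y))))).
  { apply (is_lim_seq_Rlsum (box d N) (fun M x => Rlsum (box d M) (fun y => Rabs (f x y)))).
    intros x Hx. apply Rzsum_lim. apply summable_abs. apply summable2_inner.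
    - exists B; assumption.
    - eapply box_length; eassumption. }
  exact (is_lim_seq_le _ _ _ _ (HB N) L (is_lim_seq_const B)).
Qed.

Lemma Rabs_Rzsum d f : summable d f -> Rabs (Rzsum d f) <= Rzsum d (fun x => Rabs (f x)).
Proof.
  intros Hf.
  pose proof (Rzsum_tail d f (fun x => Rabs (f x)) 0 ltac:(intros; lra) (summable_abs _ _ Hf)) as H.
  pose proof (Rlsum_abs (box d 0) f).
  pose proof (Rabs_triang (Rzsum d f - Rlsum (box d 0) f) (Rlsum (box d 0) f)) as H1.
  replace (Rzsum d f - Rlsum (box d 0) f + Rlsum (box d 0) f) with (Rzsum d f) in H1 by ring.
  lra.
Qed.

Lemma summable2_outer_abs d f :
  summable2 d f -> summable d (fun x => Rzsum d (fun y => Rabs (f x y))).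
Proof.
  intros Hf. assert (Hf' := Hf). destruct Hf as [B HB]. exists B. intros N.
  rewrite (Rlsum_ext _ _ (fun x => Rzsum d (fun y => Rabs (f x y)))).
  - now apply Rzsum2_abs_le.
  - intros x Hx. apply Rabs_pos_eq.
    eapply Rle_trans; [|apply Rlsum_box_le_Rzsum with (N := 0%nat)].
    + apply Rlsum_ge0. intros; apply Rabs_pos.
    + intros; apply Rabs_pos.
    + apply summable_abs, summable2_inner; [assumption|]. eapply box_length; eassumption.
Qed.

Lemma summable2_outer d f : summable2 d f -> summable d (fun x => Rzsum d (f x)).
Proof.
  intros Hf. eapply summable_le; [|apply (summable2_outer_abs d f Hf)].
  intros x Hx. eapply Rle_trans; [|apply Rle_abs].
  apply Rabs_Rzsum. now apply summable2_inner.
Qed.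

(** One half of Tonelli's theorem: every finite double sum, read in the other order, lies below the
    iterated sum on the right. The converse inequality follows by exchanging the two variables. *)
Lemma Rzsum_swap_le d f :
  (forall x y, 0 <= f x y) -> summable2 d f ->
  Rzsum d (fun x => Rzsum d (f x)) <= Rzsum d (fun y => Rzsum d (fun x => f x y)).
Proof.
  intros Hp Hf. assert (Hf' := summable2_swap _ _ Hf).
  assert (E : forall l x, Rlsum l (fun y => Rabs (f x y)) = Rlsum l (f x))
    by (intros; apply Rlsum_ext; intros; now apply Rabs_pos_eq).
  apply Rzsum_le_bound; [now apply summable2_outer|].
  intros N.
  rewrite (Rlsum_ext _ _ (fun x => Rzsum d (fun y => Rabs (f x y)))).
  2:{ intros. apply Rzsum_ext. intros. symmetry. now apply Rabs_pos_eq. }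
  apply Rzsum2_abs_le. intros N' M'. rewrite Rlsum_swap.
  eapply Rle_trans.
  2:{ apply Rlsum_box_le_Rzsum with (N := M'); [|now apply summable2_outer].
      intros y Hy. eapply Rle_trans; [|apply Rlsum_box_le_Rzsum with (N := 0%nat)].
      - apply Rlsum_ge0. auto.
      - auto.
      - apply (summable2_inner d (fun y x => f x y)); assumption. }
  apply Rlsum_le. intros y Hy.
  rewrite (Rlsum_ext _ _ (fun x => f x y)) by (intros; now apply Rabs_pos_eq).
  apply Rlsum_box_le_Rzsum; auto.
  apply (summable2_inner d (fun y x => f x y)); [assumption|].
  eapply box_length; eassumption.
Qed.

Lemma summable2_abs d f : summable2 d f -> summable2 d (fun x y => Rabs (f x y)).
Proof.
  intros [B HB]. exists B. intros N M. eapply Rle_trans; [|apply (HB N M)].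
  apply Rlsum_le; intros; apply Rlsum_le; intros. rewrite Rabs_Rabsolu; lra.
Qed.

Lemma summable2_plus d f g :
  summable2 d f -> summable2 d g -> summable2 d (fun x y => f x y + g x y).
Proof.
  intros [A HA] [B HB]. exists (A + B). intros N M.
  eapply Rle_trans; [|apply Rplus_le_compat; [apply (HA N M)|apply (HB N M)]].
  rewrite <- Rlsum_plus. apply Rlsum_le; intros.
  rewrite <- Rlsum_plus. apply Rlsum_le; intros. apply Rabs_triang.
Qed.

Lemma Rzsum_swap d f :
  summable2 d f ->
  Rzsum d (fun x => Rzsum d (f x)) = Rzsum d (fun y => Rzsum d (fun x => f x y)).
Proof.
  assert (P : forall g, (forall x y, 0 <= g x y) -> summable2 d g ->
    Rzsum d (fun x => Rzsum d (g x)) = Rzsum d (fun y => Rzsum d (fun x => g x y))).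
  { intros g Hp Hg. apply Rle_antisym; [now apply Rzsum_swap_le|].
    apply (Rzsum_swap_le d (fun y x => g x y)); auto. now apply summable2_swap. }
  intros Hf.
  assert (Ha := summable2_abs d f Hf).
  assert (E1 := P (fun x y => f x y + Rabs (f x y))
    ltac:(intros; pose proof (Rle_abs (- f x y)); rewrite Rabs_Ropp in *; lra)
    (summable2_plus _ _ _ Hf Ha)).
  assert (E2 := P _ ltac:(intros; apply Rabs_pos) Ha).
  cbv beta in E1, E2.
  rewrite (Rzsum_ext d _ (fun x => Rzsum d (f x) + Rzsum d (fun y => Rabs (f x y)))) in E1.
  2:{ intros x Hx. apply Rzsum_plus; [now apply summable2_inner|].
      now apply (summable2_inner d (fun x y => Rabs (f x y))). }
  rewrite (Rzsum_ext d (fun y => Rzsum d (fun x => f x y + Rabs (f x y)))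
    (fun y => Rzsum d (fun x => f x y) + Rzsum d (fun x => Rabs (f x y)))) in E1.
  2:{ intros y Hy. apply Rzsum_plus;
        [now apply (summable2_inner d (fun y x => f x y)); [apply summable2_swap|]|].
      now apply (summable2_inner d (fun y x => Rabs (f x y))); [apply summable2_swap in Ha|]. }
  rewrite !Rzsum_plus in E1.
  - lra.
  - now apply (summable2_outer d (fun y x => f x y)), summable2_swap.
  - now apply (summable2_outer d (fun y x => Rabs (f x y))),
      (summable2_swap d (fun x y => Rabs (f x y))).
  - now apply summable2_outer.
  - now apply (summable2_outer d (fun x y => Rabs (f x y))).
Qed.

(** * Sums of complex families over the lattice *)

Definition Csummable (d : nat) (f : list Z -> C) : Prop := summable d (fun x => Cmod (f x)).

Lemma zsum_pair d f :
  zsum d f = (Rzsum d (fun x => fst (f x)), Rzsum d (fun x => snd (f x))).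
Proof.
  unfold zsum, Rzsum. f_equal; f_equal; apply Lim_seq_ext; intros n.
  - apply Clsum_fst.
  - apply Clsum_snd.
Qed.

Lemma Rabs_fst_le z : Rabs (fst z) <= Cmod z.
Proof. eapply Rle_trans; [apply Rmax_l|apply Rmax_Cmod]. Qed.

Lemma Rabs_snd_le z : Rabs (snd z) <= Cmod z.
Proof. eapply Rle_trans; [apply Rmax_r|apply Rmax_Cmod]. Qed.

Lemma Cmod_sqr z : Cmod z ^ 2 = fst z * fst z + snd z * snd z.
Proof.
  unfold Cmod. rewrite pow2_sqrt; [simpl; ring|]. apply Rplus_le_le_0_compat; apply pow2_ge_0.
Qed.

Lemma Csummable_fst d f : Csummable d f -> summable d (fun x => fst (f x)).
Proof.
  apply summable_le. intros x _. rewrite (Rabs_pos_eq (Cmod _)) by apply Cmod_ge_0.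
  apply Rabs_fst_le.
Qed.

Lemma Csummable_snd d f : Csummable d f -> summable d (fun x => snd (f x)).
Proof.
  apply summable_le. intros x _. rewrite (Rabs_pos_eq (Cmod _)) by apply Cmod_ge_0.
  apply Rabs_snd_le.
Qed.

Lemma Csummable_le d f g :
  (forall x, length x = d -> Cmod (f x) <= g x) -> summable d g -> Csummable d f.
Proof.
  intros H. apply summable_le. intros x Hx. rewrite (Rabs_pos_eq (Cmod _)) by apply Cmod_ge_0.
  eapply Rle_trans; [now apply H|apply Rle_abs].
Qed.

Lemma Csummable_ext d f g :
  (forall x, length x = d -> f x = g x) -> Csummable d g -> Csummable d f.
Proof. intros H. apply Csummable_le. intros x Hx. rewrite H by assumption. lra. Qed.

Lemma Csummable_plus d f g :
  Csummable d f -> Csummable d g -> Csummable d (fun x => f x + g x)%C.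
Proof.
  intros Hf Hg. eapply Csummable_le; [|apply (summable_plus _ _ _ Hf Hg)].
  intros; apply Cmod_triangle.
Qed.

Lemma Csummable_scal d c f : Csummable d f -> Csummable d (fun x => c * f x)%C.
Proof.
  intros Hf. eapply Csummable_le; [|apply (summable_scal _ (Cmod c) _ Hf)].
  intros; rewrite Cmod_mult; lra.
Qed.

Lemma zsum_ext d f g : (forall x, length x = d -> f x = g x) -> zsum d f = zsum d g.
Proof.
  intros H. rewrite !zsum_pair. f_equal; apply Rzsum_ext; intros; now rewrite H.
Qed.

Lemma zsum_plus d f g :
  Csummable d f -> Csummable d g -> zsum d (fun x => f x + g x)%C = (zsum d f + zsum d g)%C.
Proof.
  intros Hf Hg. rewrite !zsum_pair. unfold Cplus; simpl. f_equal; apply Rzsum_plus;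
  now (apply Csummable_fst || apply Csummable_snd).
Qed.

Lemma zsum_scal d c f :
  Csummable d f -> zsum d (fun x => c * f x)%C = (c * zsum d f)%C.
Proof.
  intros Hf. pose proof (Csummable_fst _ _ Hf). pose proof (Csummable_snd _ _ Hf).
  rewrite !zsum_pair. unfold Cmult; simpl. f_equal.
  - rewrite Rzsum_minus, !Rzsum_scal; auto using summable_scal.
  - rewrite Rzsum_plus, !Rzsum_scal; auto using summable_scal.
Qed.

Lemma zsum_minus d f g :
  Csummable d f -> Csummable d g -> zsum d (fun x => f x - g x)%C = (zsum d f - zsum d g)%C.
Proof.
  intros Hf Hg.
  rewrite (zsum_ext d _ (fun x => f x + - (1) * g x)%C) by (intros; ring).
  rewrite zsum_plus, zsum_scal; [ring| | |]; auto using Csummable_scal.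
Qed.

Lemma zsum_conj d f : zsum d (fun x => Cconj (f x)) = Cconj (zsum d f).
Proof.
  rewrite !zsum_pair. unfold Cconj; simpl. f_equal. unfold Rzsum.
  rewrite (Lim_seq_ext _ (fun N => - Rlsum (box d N) (fun x => snd (f x)))).
  (* [Lim_seq_opp] holds for arbitrary sequences and [real] sends both infinities to 0, so the sign
     passes through in every case. *)
  - rewrite Lim_seq_opp. destruct (Lim_seq _); simpl; ring.
  - intros N. rewrite (Rlsum_ext _ _ (fun x => -1 * snd (f x))) by (intros; ring).
    rewrite Rlsum_scal. ring.
Qed.

(** Squared moduli are polynomial in the real and imaginary parts, so limits pass through by sums
    and products alone; they are also the quantities that Sobolev sums contain. *)
Lemma zsum_lim_sqr d f :
  Csummable d f ->
  is_lim_seq (fun N => Cmod (Clsum (box d N) f) ^ 2) (Cmod (zsum d f) ^ 2).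
Proof.
  intros Hf.
  assert (H1 := Rzsum_lim d _ (Csummable_fst _ _ Hf)).
  assert (H2 := Rzsum_lim d _ (Csummable_snd _ _ Hf)).
  rewrite Cmod_sqr, zsum_pair; simpl fst; simpl snd.
  eapply is_lim_seq_ext; [intros n; symmetry; apply Cmod_sqr|].
  apply is_lim_seq_plus'; apply is_lim_seq_mult';
  (eapply is_lim_seq_ext; [intros n; symmetry; (apply Clsum_fst || apply Clsum_snd)|assumption]).
Qed.

Lemma Cmod_zsum_le d f B :
  Csummable d f -> 0 <= B -> (forall N, Cmod (Clsum (box d N) f) <= B) -> Cmod (zsum d f) <= B.
Proof.
  intros Hf HB H.
  assert (L : Rbar_le (Cmod (zsum d f) ^ 2) (B ^ 2)).
  { refine (is_lim_seq_le _ _ _ _ _ (zsum_lim_sqr d f Hf) (is_lim_seq_const (B ^ 2))).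
    intros n. apply pow_incr. split; [apply Cmod_ge_0|apply H]. }
  simpl in L. pose proof (Cmod_ge_0 (zsum d f)). nra.
Qed.

Lemma Rzsum_ge0 d f :
  (forall x, length x = d -> 0 <= f x) -> summable d f -> 0 <= Rzsum d f.
Proof.
  intros Hp Hf. eapply Rle_trans; [|apply (Rlsum_box_le_Rzsum d f 0 Hp Hf)].
  apply Rlsum_ge0. intros x Hx. apply Hp. now apply box_length in Hx.
Qed.

Lemma Cmod_zsum d f g :
  (forall x, length x = d -> Cmod (f x) <= g x) -> summable d g ->
  Cmod (zsum d f) <= Rzsum d g.
Proof.
  intros H Hg.
  assert (Hp : forall x, length x = d -> 0 <= g x)
    by (intros x Hx; eapply Rle_trans; [apply Cmod_ge_0|now apply H]).
  apply Cmod_zsum_le; [eapply Csummable_le; eassumption|now apply Rzsum_ge0|].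
  intros N. eapply Rle_trans; [apply Cmod_Clsum|].
  eapply Rle_trans; [|apply (Rlsum_box_le_Rzsum d g N Hp Hg)].
  apply Rlsum_le. intros x Hx. apply H. now apply box_length in Hx.
Qed.

Lemma zsum_RtoC d g : zsum d (fun x => RtoC (g x)) = RtoC (Rzsum d g).
Proof.
  rewrite zsum_pair. unfold RtoC; simpl. f_equal.
  unfold Rzsum. rewrite (Lim_seq_ext _ (fun _ => 0)).
  - now rewrite Lim_seq_const.
  - intros N. rewrite (Rlsum_ext _ _ (fun x => 0 * 0)) by (intros; ring).
    rewrite Rlsum_scal. ring.
Qed.

Lemma zsum_reindex d s f :
  (forall x, length x = d -> length (s x) = d) ->
  (forall x, length x = d -> s (s x) = x) ->
  Csummable d f -> zsum d (fun x => f (s x)) = zsum d f.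
Proof.
  intros Hs Hss Hf. rewrite !zsum_pair. f_equal.
  - apply (Rzsum_reindex d s (fun x => fst (f x))); auto using Csummable_fst.
  - apply (Rzsum_reindex d s (fun x => snd (f x))); auto using Csummable_snd.
Qed.

Definition Csummable2 (d : nat) (f : list Z -> list Z -> C) : Prop :=
  summable2 d (fun x y => Cmod (f x y)).

Lemma summable2_le d f g :
  (forall x y, length x = d -> length y = d -> Rabs (f x y) <= Rabs (g x y)) ->
  summable2 d g -> summable2 d f.
Proof.
  intros H [B HB]. exists B. intros N M. eapply Rle_trans; [|apply (HB N M)].
  apply Rlsum_le; intros x Hx; apply Rlsum_le; intros y Hy.
  apply H; eapply box_length; eassumption.
Qed.

Lemma zsum_swap d f :
  Csummable2 d f ->
  zsum d (fun x => zsum d (f x)) = zsum d (fun y => zsum d (fun x => f x y)).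
Proof.
  intros Hf. rewrite !zsum_pair. f_equal.
  - rewrite (Rzsum_ext d _ (fun x => Rzsum d (fun y => fst (f x y))))
      by (intros; now rewrite zsum_pair).
    rewrite (Rzsum_ext d (fun y => fst _) (fun y => Rzsum d (fun x => fst (f x y))))
      by (intros; now rewrite zsum_pair).
    apply (Rzsum_swap d (fun x y => fst (f x y))).
    eapply summable2_le; [|apply Hf]. intros; simpl.
    rewrite (Rabs_pos_eq (Cmod _)) by apply Cmod_ge_0. apply Rabs_fst_le.
  - rewrite (Rzsum_ext d _ (fun x => Rzsum d (fun y => snd (f x y))))
      by (intros; now rewrite zsum_pair).
    rewrite (Rzsum_ext d (fun y => snd _) (fun y => Rzsum d (fun x => snd (f x y))))
      by (intros; now rewrite zsum_pair).
    apply (Rzsum_swap d (fun x y => snd (f x y))).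
    eapply summable2_le; [|apply Hf]. intros; simpl.
    rewrite (Rabs_pos_eq (Cmod _)) by apply Cmod_ge_0. apply Rabs_snd_le.
Qed.

Lemma Csummable2_inner d f x : Csummable2 d f -> length x = d -> Csummable d (f x).
Proof. apply (summable2_inner d (fun x y => Cmod (f x y))). Qed.

Lemma Csummable2_outer d f : Csummable2 d f -> Csummable d (fun x => zsum d (f x)).
Proof.
  intros Hf. eapply Csummable_le; [|apply (summable2_outer_abs _ _ Hf)].
  intros x Hx. apply Cmod_zsum.
  - intros; simpl. apply Rle_abs.
  - apply summable_abs. now apply Csummable2_inner.
Qed.

(** * Frequency vectors *)

Lemma nrm2_cons k x : nrm2 (k :: x) = IZR k * IZR k + nrm2 x.
Proof. unfold nrm2; simpl. now rewrite plus_IZR, mult_IZR. Qed.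

Lemma nrm2_ge0 x : 0 <= nrm2 x.
Proof.
  induction x as [|k x IH]; [unfold nrm2; simpl; lra|].
  rewrite nrm2_cons. pose proof (Rle_0_sqr (IZR k)). unfold Rsqr in *; lra.
Qed.

Lemma vsub_length d x y : length x = d -> length y = d -> length (vsub x y) = d.
Proof. intros. unfold vsub. rewrite length_map, length_combine. lia. Qed.

Lemma vneg_length d x : length x = d -> length (vneg x) = d.
Proof. intros. unfold vneg. now rewrite length_map. Qed.

Lemma vsub_cons a x b y : vsub (a :: x) (b :: y) = (a - b)%Z :: vsub x y.
Proof. reflexivity. Qed.

Lemma vsub_vsub d x y : length x = d -> length y = d -> vsub x (vsub x y) = y.
Proof.
  revert d y; induction x as [|a x IH]; intros d [|b y] Hx Hy; simpl in *; subst;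
    try discriminate; [reflexivity|].
  rewrite !vsub_cons. f_equal; [lia|]. apply (IH (length x)); [reflexivity|lia].
Qed.

Lemma vsub_comm d x y z :
  length x = d -> length y = d -> length z = d -> vsub (vsub x y) z = vsub (vsub x z) y.
Proof.
  revert d y z; induction x as [|a x IH]; intros d [|b y] [|c z] Hx Hy Hz; simpl in *; subst;
    try discriminate; [reflexivity|].
  rewrite !vsub_cons. f_equal; [lia|]. apply (IH (length x)); [reflexivity|lia|lia].
Qed.

Lemma vneg_vneg x : vneg (vneg x) = x.
Proof. induction x as [|a x IH]; simpl; [reflexivity|]. f_equal; [lia|apply IH]. Qed.

Lemma vneg_vsub d x y :
  length x = d -> length y = d -> vneg (vsub x y) = vsub (vneg x) (vneg y).
Proof.
  revert d y; induction x as [|a x IH]; intros d [|b y] Hx Hy; simpl in *; subst;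
    try discriminate; [reflexivity|].
  rewrite !vsub_cons. simpl. f_equal; [lia|]. apply (IH (length x)); [reflexivity|lia].
Qed.

Lemma nrm2_vneg x : nrm2 (vneg x) = nrm2 x.
Proof.
  induction x as [|a x IH]; [reflexivity|].
  change (vneg (a :: x)) with ((- a)%Z :: vneg x). rewrite !nrm2_cons, opp_IZR, IH. ring.
Qed.

(** Cauchy-Schwarz: the difference on the left is twice the dot product of [y] and [vsub x y]. That
    dot product is the witness [D], built along the induction. *)
Lemma nrm2_cross d x y :
  length x = d -> length y = d ->
  (nrm2 x - nrm2 y - nrm2 (vsub x y)) ^ 2 <= 4 * (nrm2 y * nrm2 (vsub x y)).
Proof.
  intros Hx Hy.
  enough (exists D, nrm2 x = nrm2 y + nrm2 (vsub x y) + 2 * D /\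
    D ^ 2 <= nrm2 y * nrm2 (vsub x y)) as [D [-> HD]].
  { simpl in *. nra. }
  revert d y Hx Hy; induction x as [|a x IH]; intros d [|b y] Hx Hy; simpl in *; subst;
    try discriminate.
  - exists 0. unfold nrm2; simpl. lra.
  - destruct (IH (length x) y) as [D [HD1 HD2]]; [reflexivity|lia|].
    rewrite vsub_cons, !nrm2_cons, minus_IZR.
    exists (IZR b * (IZR a - IZR b) + D). split; [rewrite HD1; ring|].
    assert (T := CS_step D _ _ (IZR b) (IZR a - IZR b) HD2 (nrm2_ge0 _) (nrm2_ge0 _)).
    simpl in *. lra.
Qed.

Lemma nrm2_vsub_le d x y :
  length x = d -> length y = d -> nrm2 x <= 2 * nrm2 y + 2 * nrm2 (vsub x y).
Proof.
  intros Hx Hy. pose proof (nrm2_cross d x y Hx Hy) as H.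
  pose proof (nrm2_ge0 y). pose proof (nrm2_ge0 (vsub x y)).
  revert H H0 H1. generalize (nrm2 x), (nrm2 y), (nrm2 (vsub x y)). intros a b c H Hb Hc.
  apply Rnot_lt_le. intros Ha.
  assert ((b + c) ^ 2 < (a - b - c) ^ 2) by (simpl; nra).
  pose proof (pow2_ge_0 (b - c)). nra.
Qed.

(* The oscillating phase left once the diagonal part [2|x|^2] is integrated exactly is at
   most bilinear in any two of the three frequencies, hence no frequency is squared. *)
Lemma resonance_bound d xi x y :
  length xi = d -> length x = d -> length y = d ->
  (nrm2 xi - nrm2 x - nrm2 y - nrm2 (vsub (vsub xi x) y)) ^ 2
    <= 36 * ((1 + nrm2 x) * ((1 + nrm2 y) * (1 + nrm2 (vsub (vsub xi x) y)))).
Proof.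
  intros H1 H2 H3.
  assert (Hp := vsub_length d xi x H1 H2).
  pose proof (nrm2_cross d xi x H1 H2) as C1.
  pose proof (nrm2_cross d (vsub xi x) y Hp H3) as C2.
  pose proof (nrm2_vsub_le d (vsub xi x) y Hp H3) as C3.
  pose proof (nrm2_ge0 x). pose proof (nrm2_ge0 y). pose proof (nrm2_ge0 (vsub xi x)).
  pose proof (nrm2_ge0 (vsub (vsub xi x) y)).
  revert C1 C2 C3 H H0 H4 H5.
  generalize (nrm2 xi), (nrm2 x), (nrm2 y), (nrm2 (vsub xi x)), (nrm2 (vsub (vsub xi x) y)).
  intros a b c p q C1 C2 C3 Hb Hc Hpp Hq.
  (* With [p] the frequency left after removing [x], [u] is twice the dot product of [x] with that
     remainder and [v] twice that of [y] with the last frequency. Their squares contribute 8 and 4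
     units, so the square of the sum is at most 24. *)
  set (u := a - b - p) in *. set (v := p - c - q) in *.
  replace (a - b - c - q) with (u + v) by (unfold u, v; ring).
  assert (u ^ 2 <= 8 * ((1 + b) * ((1 + c) * (1 + q)))).
  { eapply Rle_trans; [exact C1|].
    assert (b * p <= (1 + b) * (2 * c + 2 * q)) by nra.
    assert (0 <= (1 + b) * (1 + c * q)) by (apply Rmult_le_pos; nra). nra. }
  assert (v ^ 2 <= 4 * ((1 + b) * ((1 + c) * (1 + q)))).
  { eapply Rle_trans; [exact C2|]. assert (0 <= c * q) by nra.
    assert (c * q <= (1 + c) * (1 + q)) by nra.
    assert (0 <= b * ((1 + c) * (1 + q))) by (apply Rmult_le_pos; nra). nra. }
  nra.
Qed.

(** * Sobolev weights *)

Definition wt (s : R) (x : list Z) : R := Rpower (1 + nrm2 x) s.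

Lemma wt_pos s x : 0 < wt s x.
Proof. apply exp_pos. Qed.

Lemma wt_succ2 s x : wt (s + 2) x = wt s x * (1 + nrm2 x) ^ 2.
Proof.
  unfold wt. pose proof (nrm2_ge0 x). rewrite Rpower_plus. f_equal.
  replace 2 with (INR 2) at 1 by (simpl; ring). apply Rpower_pow. lra.
Qed.

Lemma wt_vneg s x : wt s (vneg x) = wt s x.
Proof. unfold wt. now rewrite nrm2_vneg. Qed.

(** * Summability of the inverse weights *)

Lemma Rpower_anti a b p : 0 < a <= b -> 0 <= p -> Rpower b (- p) <= Rpower a (- p).
Proof.
  intros H Hp. rewrite !Rpower_Ropp. apply Rinv_le_contravar; [apply exp_pos|].
  now apply Rle_Rpower_l.
Qed.

(** The integral test in telescoping form, by the mean value theorem for [x^(-q)] on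
    [[m - 1, m]]. *)
Lemma Rpower_telescope q m :
  0 < q -> 1 < m -> Rpower m (- (1 + q)) <= (Rpower (m - 1) (- q) - Rpower m (- q)) / q.
Proof.
  intros Hq Hm.
  destruct (MVT_cor2 (fun x => Rpower x (- q)) (fun x => - q * Rpower x (- q - 1)) (m - 1) m)
    as [c [Hc Hc']]; [lra| |].
  - intros c Hc. apply derivable_pt_lim_power. lra.
  - apply Rmult_le_reg_l with q; [assumption|].
    replace (q * ((Rpower (m - 1) (- q) - Rpower m (- q)) / q))
      with (Rpower (m - 1) (- q) - Rpower m (- q)) by (field; lra).
    replace (Rpower (m - 1) (- q) - Rpower m (- q)) with (q * Rpower c (- (1 + q))).
    + apply Rmult_le_compat_l; [lra|]. apply Rpower_anti; lra.
    + replace (- q - 1) with (- (1 + q)) in Hc by ring. simpl in Hc. lra.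
Qed.

Definition Zlsum (l : list Z) (f : Z -> R) : R := fold_right (fun k acc => f k + acc) 0 l.

Lemma Zlsum_cons k l f : Zlsum (k :: l) f = f k + Zlsum l f.
Proof. reflexivity. Qed.

Lemma Zlsum_app l m f : Zlsum (l ++ m) f = Zlsum l f + Zlsum m f.
Proof. induction l as [|a l IH]; simpl; [|rewrite IH]; ring. Qed.

Lemma Zlsum_ge0 l f : (forall k, 0 <= f k) -> 0 <= Zlsum l f.
Proof. intros H; induction l as [|a l IH]; simpl; [lra|]. specialize (H a); lra. Qed.

Lemma zrange_S N :
  zrange (S N) = (- Z.of_nat (S N))%Z :: zrange N ++ Z.of_nat (S N) :: nil.
Proof.
  unfold zrange. replace (2 * S N + 1)%nat with (S (2 * N + 1 + 1)) by lia.
  rewrite <- cons_seq, seq_app, <- (seq_shift (2 * N + 1) 0).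
  rewrite map_cons, map_app, map_map. f_equal; f_equal.
  - apply map_ext. intros; lia.
  - unfold seq, map. f_equal. lia.
Qed.

Lemma lattice_sum_1d p :
  1 / 2 < p -> exists B, forall N,
    Zlsum (zrange N) (fun k => Rpower (1 + IZR k * IZR k) (- p)) <= B.
Proof.
  intros Hp. set (q := 2 * p - 1). assert (Hq : 0 < q) by (unfold q; lra).
  (* The factor 2 counts the frequencies [n] and [-n], [2^p] comes from [1 + n^2 >= (n + 1)^2 / 2],
     and [1 / q] from the telescoping estimate with [1 + q = 2 p]. *)
  set (c := 2 * Rpower 2 p / q).
  assert (Hc : 0 < c).
  { unfold c. apply Rdiv_lt_0_compat; [|assumption].
    apply Rmult_lt_0_compat; [lra|apply exp_pos]. }
  exists (1 + c).
  (* The subtracted term makes the bound inductive: enlarging the range adds at most what this term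
     loses. *)
  enough (forall N, Zlsum (zrange N) (fun k => Rpower (1 + IZR k * IZR k) (- p))
    <= 1 + c - c * Rpower (INR N + 1) (- q)).
  { intros N. specialize (H N). assert (0 < Rpower (INR N + 1) (- q)) by apply exp_pos. nra. }
  induction N as [|N IH].
  - simpl. rewrite Rplus_0_l, Rmult_0_l, !Rplus_0_r. unfold Rpower. rewrite ln_1, !Rmult_0_r, exp_0.
    lra.
  - rewrite zrange_S. simpl Zlsum. rewrite Zlsum_app. simpl Zlsum.
    set (n := IZR (Z.of_nat (S N))).
    change (IZR (Z.pos (Pos.of_succ_nat N))) with n.
    assert (Hn : n = INR N + 1) by (unfold n; rewrite <- INR_IZR_INZ, S_INR; reflexivity).
    assert (Hn0 : 1 <= n) by (rewrite Hn; pose proof (pos_INR N); lra).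
    change (Z.neg (Pos.of_succ_nat N)) with (- Z.of_nat (S N))%Z.
    replace (IZR (- Z.of_nat (S N)) * IZR (- Z.of_nat (S N))) with (n * n)
      by (unfold n; rewrite opp_IZR; ring).
    rewrite ?S_INR, <- Hn in *.
    assert (H1 : Rpower (1 + n * n) (- p) <= Rpower 2 p * Rpower (n + 1) (- (1 + q))).
    { replace (- (1 + q)) with (- p + - p) by (unfold q; ring).
      rewrite Rpower_plus, Rpower_mult_distr by lra.
      replace (Rpower 2 p) with (Rpower (/ 2) (- p)).
      - rewrite Rpower_mult_distr by (try apply Rmult_lt_0_compat; lra).
        apply Rpower_anti; [|lra]. split; nra.
      - unfold Rpower. rewrite ln_Rinv by lra. f_equal. ring. }
    assert (H2 := Rpower_telescope q (n + 1) Hq ltac:(lra)).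
    replace (n + 1 - 1) with n in H2 by ring.
    assert (H3 : 2 * (Rpower 2 p * Rpower (n + 1) (- (1 + q)))
      <= c * (Rpower n (- q) - Rpower (n + 1) (- q))).
    { unfold c.
      replace (2 * Rpower 2 p / q * (Rpower n (- q) - Rpower (n + 1) (- q)))
        with (2 * (Rpower 2 p * ((Rpower n (- q) - Rpower (n + 1) (- q)) / q))) by (field; lra).
      apply Rmult_le_compat_l; [lra|]. apply Rmult_le_compat_l; [left; apply exp_pos|assumption]. }
    lra.
Qed.

Definition prodw (p : R) (x : list Z) : R :=
  fold_right (fun k acc => Rpower (1 + IZR k * IZR k) (- p) * acc) 1 x.

Lemma Rlsum_box_S d N f :
  Rlsum (box (S d) N) f = Zlsum (zrange N) (fun k => Rlsum (box d N) (fun x => f (k :: x))).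
Proof.
  simpl. induction (zrange N) as [|k l IH]; simpl; [reflexivity|].
  rewrite Rlsum_app, Rlsum_map, IH. reflexivity.
Qed.

Lemma prodw_sum p d N :
  Rlsum (box d N) (prodw p)
    = (Zlsum (zrange N) (fun k => Rpower (1 + IZR k * IZR k) (- p))) ^ d.
Proof.
  induction d as [|d IH]; [simpl; ring|].
  rewrite Rlsum_box_S. simpl pow. rewrite <- IH. clear IH.
  induction (zrange N) as [|k l IHl]; [simpl; ring|].
  rewrite !Zlsum_cons, IHl.
  change (fun x => prodw p (k :: x)) with (fun x => Rpower (1 + IZR k * IZR k) (- p) * prodw p x).
  rewrite Rlsum_scal. ring.
Qed.

(** Keeping [n] apart from [nrm2 x] lets the induction drop a coordinate while the full weight
    [1 + n] stays in place. *)
Lemma prodw_ge p n x :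
  0 <= p -> nrm2 x <= n -> Rpower (1 + n) (- (p * INR (length x))) <= prodw p x.
Proof.
  intros Hp. revert n; induction x as [|k x IH]; intros n Hn.
  - simpl. rewrite Rmult_0_r, Ropp_0. rewrite Rpower_O; [lra|].
    unfold nrm2 in Hn; simpl in Hn; lra.
  - rewrite nrm2_cons in Hn. simpl prodw. simpl length. rewrite S_INR.
    replace (- (p * (INR (length x) + 1))) with (- p + - (p * INR (length x))) by ring.
    rewrite Rpower_plus. pose proof (nrm2_ge0 x). pose proof (Rle_0_sqr (IZR k)). unfold Rsqr in *.
    apply Rmult_le_compat; try (left; apply exp_pos).
    + apply Rpower_anti; lra.
    + apply IH. lra.
Qed.

(** Sharing the exponent equally among the coordinates, [(1 + |x|^2)^(-s)] is at most the product of
    the [(1 + x_j^2)^(-s/d)]. The sum then factorises, and [s > d/2] becomes the one-dimensional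
    condition [s/d > 1/2]. *)
Lemma lattice_sum d s :
  (1 <= d)%nat -> INR d / 2 < s -> exists B, forall N, Rlsum (box d N) (fun x => / wt s x) <= B.
Proof.
  intros Hd Hs. assert (Hd' : 1 <= INR d) by (apply (le_INR 1); assumption).
  assert (Hp : 1 / 2 < s / INR d).
  { apply Rmult_lt_reg_r with (INR d); [lra|]. replace (s / INR d * INR d) with s by (field; lra). lra. }
  destruct (lattice_sum_1d _ Hp) as [B HB]. exists (B ^ d). intros N.
  eapply Rle_trans; [|apply pow_incr; split; [|apply (HB N)]; apply Zlsum_ge0;
    intros; left; apply exp_pos].
  rewrite <- prodw_sum. apply Rlsum_le. intros x Hx. apply box_length in Hx.
  unfold wt. rewrite <- Rpower_Ropp.
  replace (- s) with (- (s / INR d * INR (length x))) by (rewrite Hx; field; lra).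
  apply prodw_ge; lra.
Qed.

(** The larger of the two frequencies carries the weight: [|x|^2] is at most 4 times the larger of
    [|y|^2] and [|x - y|^2]. *)
Lemma wt_vsub_le d s x y :
  0 <= s -> length x = d -> length y = d ->
  wt s x <= Rpower 4 s * (wt s y + wt s (vsub x y)).
Proof.
  intros Hs Hx Hy. pose proof (nrm2_vsub_le d x y Hx Hy).
  pose proof (nrm2_ge0 x). pose proof (nrm2_ge0 y). pose proof (nrm2_ge0 (vsub x y)).
  pose proof (wt_pos s y). pose proof (wt_pos s (vsub x y)).
  assert (0 < Rpower 4 s) by apply exp_pos.
  destruct (Rle_dec (nrm2 y) (nrm2 (vsub x y))).
  - apply Rle_trans with (Rpower 4 s * wt s (vsub x y)); [|nra].
    unfold wt. rewrite Rpower_mult_distr by lra. apply Rle_Rpower_l; lra.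
  - apply Rle_trans with (Rpower 4 s * wt s y); [|nra].
    unfold wt. rewrite Rpower_mult_distr by lra. apply Rle_Rpower_l; lra.
Qed.

(** The source of the algebra property. The weight of [x] is bounded by those of [y] and [x - y],
    which cancels one of the two inverse weights and leaves two lattice sums. The [+ 1] in the
    witness makes it strictly positive. *)
Lemma kernel_bound d s :
  (1 <= d)%nat -> INR d / 2 < s -> exists K, 0 < K /\ forall x N, length x = d ->
    Rlsum (box d N) (fun y => wt s x * (/ wt s y * / wt s (vsub x y))) <= K.
Proof.
  intros Hd Hs. destruct (lattice_sum d s Hd Hs) as [B HB].
  assert (Hs0 : 0 <= s) by (pose proof (pos_INR d); lra).
  exists (Rpower 4 s * (2 * (Rabs B + 1))). assert (0 < Rpower 4 s) by apply exp_pos.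
  pose proof (Rabs_pos B). pose proof (Rle_abs B).
  split; [nra|]. intros x N Hx.
  apply Rle_trans with (Rlsum (box d N) (fun y => Rpower 4 s * (/ wt s y + / wt s (vsub x y)))).
  - apply Rlsum_le. intros y Hy. apply box_length in Hy.
    pose proof (wt_vsub_le d s x y Hs0 Hx Hy).
    pose proof (wt_pos s y). pose proof (wt_pos s (vsub x y)).
    apply Rle_trans with (Rpower 4 s * (wt s y + wt s (vsub x y)) * (/ wt s y * / wt s (vsub x y))).
    + apply Rmult_le_compat_r; [|assumption]. left. apply Rmult_lt_0_compat; now apply Rinv_0_lt_compat.
    + right. field. lra.
  - rewrite Rlsum_scal, Rlsum_plus. apply Rmult_le_compat_l; [lra|].
    specialize (HB N) as HB1.
    assert (HB2 : Rlsum (box d N) (fun y => / wt s (vsub x y)) <= B).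
    { rewrite <- (Rlsum_map (vsub x) _ (fun y => / wt s y)).
      apply Rlsum_le_of_box with d; auto.
      - intros y _. left. apply Rinv_0_lt_compat, wt_pos.
      - apply NoDup_map_NoDup_ForallPairs; [|apply NoDup_box].
        intros y z Hy Hz E. apply box_length in Hy. apply box_length in Hz.
        rewrite <- (vsub_vsub d x y), <- (vsub_vsub d x z) by assumption. now f_equal.
      - intros y Hy. apply in_map_iff in Hy. destruct Hy as [z [<- Hz]].
        apply box_length in Hz. now apply vsub_length. }
    lra.
Qed.

(** * Sobolev norms *)

(* [A] bounds the [H^s] norm of [a] up to the factor [(2 pi)^(d/2)]. *)
Definition Hb (d : nat) (s : R) (a : Four) (A : R) : Prop :=
  0 <= A /\ forall N, Rlsum (box d N) (fun x => wt s x * Cmod (a x) ^ 2) <= A ^ 2.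

Lemma Hb_dom d s a b A :
  (forall x, length x = d -> Cmod (a x) <= Cmod (b x)) -> Hb d s b A -> Hb d s a A.
Proof.
  intros H [HA HB]. split; [assumption|]. intros N. eapply Rle_trans; [|apply (HB N)].
  apply Rlsum_le. intros x Hx. apply box_length in Hx.
  apply Rmult_le_compat_l; [left; apply wt_pos|]. apply pow_incr.
  split; [apply Cmod_ge_0|auto].
Qed.

Lemma Hb_ext d s a b A :
  (forall x, length x = d -> a x = b x) -> Hb d s b A -> Hb d s a A.
Proof. intros H. apply Hb_dom. intros x Hx. rewrite H by assumption. lra. Qed.

Lemma Hb_le d s a A B : A <= B -> Hb d s a A -> Hb d s a B.
Proof.
  intros H [HA HB]. split; [lra|]. intros N. eapply Rle_trans; [apply HB|].
  apply pow_incr; lra.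
Qed.

Lemma Hb_scal d s c a A : Hb d s a A -> Hb d s (fun x => c * a x)%C (Cmod c * A).
Proof.
  intros [HA HB]. pose proof (Cmod_ge_0 c). split; [now apply Rmult_le_pos|].
  intros N. rewrite (Rlsum_ext _ _ (fun x => Cmod c ^ 2 * (wt s x * Cmod (a x) ^ 2))).
  - rewrite Rlsum_scal, Rpow_mult_distr. apply Rmult_le_compat_l; [apply pow2_ge_0|apply HB].
  - intros x _. rewrite Cmod_mult. ring.
Qed.

Lemma Hb_bound d s c a b A :
  0 <= c -> (forall x, length x = d -> Cmod (b x) <= c * Cmod (a x)) -> Hb d s a A ->
  Hb d s b (c * A).
Proof.
  intros Hc H HA. apply (Hb_dom d s b (fun x => RtoC c * a x)%C).
  - intros x Hx. rewrite Cmod_mult, Cmod_R, (Rabs_pos_eq c Hc). auto.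
  - pose proof (Hb_scal d s (RtoC c) a A HA) as T.
    now rewrite Cmod_R, (Rabs_pos_eq c Hc) in T.
Qed.

Lemma Hb_0 d s : Hb d s (fun _ => 0%C) 0.
Proof.
  split; [lra|]. intros N. rewrite (Rlsum_ext _ _ (fun x => 0 * 0)).
  - rewrite Rlsum_scal. lra.
  - intros. rewrite Cmod_0. ring.
Qed.

Lemma wt_CS l s (a b : Four) :
  (Rlsum l (fun x => wt s x * (Cmod (a x) * Cmod (b x)))) ^ 2
    <= Rlsum l (fun x => wt s x * Cmod (a x) ^ 2) * Rlsum l (fun x => wt s x * Cmod (b x) ^ 2).
Proof.
  assert (CS := Rlsum_CS l (fun x => sqrt (wt s x) * Cmod (a x))
                  (fun x => sqrt (wt s x) * Cmod (b x))).
  cbv beta in CS.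
  assert (E : forall f : Four, Rlsum l (fun x => (sqrt (wt s x) * Cmod (f x)) ^ 2)
    = Rlsum l (fun x => wt s x * Cmod (f x) ^ 2)).
  { intros f. apply Rlsum_ext. intros. rewrite Rpow_mult_distr, pow2_sqrt; [reflexivity|].
    left; apply wt_pos. }
  rewrite !E in CS.
  rewrite (Rlsum_ext l _ (fun x => sqrt (wt s x) * Cmod (a x) * (sqrt (wt s x) * Cmod (b x))));
    [exact CS|].
  intros x _. pose proof (wt_pos s x) as Hw.
  rewrite <- (sqrt_sqrt (wt s x)) at 1 by lra. ring.
Qed.

Lemma wt_sum_ge0 l s (a : Four) : 0 <= Rlsum l (fun x => wt s x * Cmod (a x) ^ 2).
Proof.
  apply Rlsum_ge0. intros. apply Rmult_le_pos; [left; apply wt_pos|apply pow2_ge_0].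
Qed.

Lemma Hb_plus d s a b A B :
  Hb d s a A -> Hb d s b B -> Hb d s (fun x => a x + b x)%C (A + B).
Proof.
  intros [HA Ha] [HB Hb']. split; [lra|]. intros N.
  specialize (Ha N). specialize (Hb' N).
  assert (CS := wt_CS (box d N) s a b).
  set (P := Rlsum (box d N) (fun x => wt s x * (Cmod (a x) * Cmod (b x)))) in *.
  assert (HP : P <= A * B).
  { apply Rnot_lt_le; intros H.
    assert (P ^ 2 <= A ^ 2 * B ^ 2).
    { eapply Rle_trans; [exact CS|]. apply Rmult_le_compat; auto using wt_sum_ge0. }
    assert (0 <= A * B) by now apply Rmult_le_pos. nra. }
  apply Rle_trans with (Rlsum (box d N) (fun x => wt s x * Cmod (a x) ^ 2
    + (2 * (wt s x * (Cmod (a x) * Cmod (b x))) + wt s x * Cmod (b x) ^ 2))).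
  - apply Rlsum_le. intros x _. pose proof (wt_pos s x).
    replace (wt s x * Cmod (a x) ^ 2 + (2 * (wt s x * (Cmod (a x) * Cmod (b x)))
      + wt s x * Cmod (b x) ^ 2)) with (wt s x * (Cmod (a x) + Cmod (b x)) ^ 2) by ring.
    apply Rmult_le_compat_l; [lra|]. apply pow_incr.
    split; [apply Cmod_ge_0|apply Cmod_triangle].
  - rewrite !Rlsum_plus, Rlsum_scal. fold P. nra.
Qed.

Lemma Hb_mono d s a A : Hb d (s + 2) a A -> Hb d s a A.
Proof.
  intros [HA HB]. split; [assumption|]. intros N. eapply Rle_trans; [|apply (HB N)].
  apply Rlsum_le. intros x _. rewrite wt_succ2.
  pose proof (wt_pos s x). pose proof (nrm2_ge0 x). pose proof (pow2_ge_0 (Cmod (a x))).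
  apply Rmult_le_compat_r; [assumption|]. assert (1 <= (1 + nrm2 x) ^ 2) by nra. nra.
Qed.

(** How derivatives are spent: a factor [1 + nrm2 x] on the coefficients is compensated exactly by
    raising the exponent by 2. The losses of the local analysis are all brought to this form. *)
Lemma Hb_gain d s c a b A :
  0 <= c -> (forall x, length x = d -> Cmod (b x) <= c * (1 + nrm2 x) * Cmod (a x)) ->
  Hb d (s + 2) a A -> Hb d s b (c * A).
Proof.
  intros Hc H HA. apply (Hb_bound d s c (fun x => RtoC (1 + nrm2 x) * a x)%C); [assumption| |].
  - intros x Hx. pose proof (nrm2_ge0 x).
    rewrite Cmod_mult, Cmod_R, Rabs_pos_eq by lra. rewrite <- Rmult_assoc. auto.
  - destruct HA as [HA HB]. split; [assumption|]. intros N. eapply Rle_trans; [|apply (HB N)].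
    apply Rlsum_le. intros x _. rewrite wt_succ2. pose proof (nrm2_ge0 x).
    rewrite Cmod_mult, Cmod_R, Rabs_pos_eq by lra. right; ring.
Qed.

Lemma Hb_conj d s a A : Hb d s a A -> Hb d s (conjF a) A.
Proof.
  intros [HA HB]. split; [assumption|]. intros N.
  rewrite (Rlsum_ext _ _ (fun x => wt s (vneg x) * Cmod (a (vneg x)) ^ 2)).
  - rewrite <- (Rlsum_map vneg _ (fun x => wt s x * Cmod (a x) ^ 2)).
    apply Rlsum_le_of_box with d; auto.
    + intros. apply Rmult_le_pos; [left; apply wt_pos|apply pow2_ge_0].
    + apply Injective_map_NoDup; [|apply NoDup_box].
      intros x y E. rewrite <- (vneg_vneg x), <- (vneg_vneg y). now f_equal.
    + intros x Hx. apply in_map_iff in Hx. destruct Hx as [z [<- Hz]].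
      apply box_length in Hz. now apply vneg_length.
  - intros x _. unfold conjF. now rewrite wt_vneg, Cmod_conj.
Qed.

(** * The convolution algebra *)

Section Algebra.
Variables (d : nat) (s K : R).
Hypothesis K_pos : 0 < K.
Hypothesis K_bound : forall x N, length x = d ->
  Rlsum (box d N) (fun y => wt s x * (/ wt s y * / wt s (vsub x y))) <= K.

(** Inserting [r / r], with [r] the geometric mean of the weights of [y] and [x - y], lets
    Cauchy-Schwarz separate the kernel from the product of the two weighted squares. *)
Lemma conv_CS a b x N :
  length x = d ->
  wt s x * (Rlsum (box d N) (fun y => Cmod (a y) * Cmod (b (vsub x y)))) ^ 2
    <= K * Rlsum (box d N) (fun y => (wt s y * Cmod (a y) ^ 2)
           * (wt s (vsub x y) * Cmod (b (vsub x y)) ^ 2)).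
Proof.
  intros Hx. set (r := fun y => sqrt (wt s y * wt s (vsub x y))).
  assert (Hr : forall y, 0 < r y)
    by (intros y; apply sqrt_lt_R0, Rmult_lt_0_compat; apply wt_pos).
  assert (Hr2 : forall y, r y ^ 2 = wt s y * wt s (vsub x y)).
  { intros y. unfold r. rewrite pow2_sqrt; [reflexivity|].
    left; apply Rmult_lt_0_compat; apply wt_pos. }
  assert (CS := Rlsum_CS (box d N) (fun y => / r y)
    (fun y => r y * (Cmod (a y) * Cmod (b (vsub x y))))).
  cbv beta in CS.
  rewrite (Rlsum_ext _ (fun y => / r y * (r y * _)) (fun y => Cmod (a y) * Cmod (b (vsub x y)))) in CS.
  2:{ intros y _. specialize (Hr y). field. lra. }
  rewrite (Rlsum_ext _ (fun y => (r y * _) ^ 2) (fun y => (wt s y * Cmod (a y) ^ 2)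
           * (wt s (vsub x y) * Cmod (b (vsub x y)) ^ 2))) in CS.
  2:{ intros y _. rewrite Rpow_mult_distr, Hr2. ring. }
  eapply Rle_trans; [apply Rmult_le_compat_l; [left; apply wt_pos|exact CS]|].
  rewrite <- Rmult_assoc. apply Rmult_le_compat_r.
  - apply Rlsum_ge0. intros. apply Rmult_le_pos; apply Rmult_le_pos;
      (left; apply wt_pos) || apply pow2_ge_0.
  - rewrite <- Rlsum_scal. eapply Rle_trans; [|apply (K_bound x N Hx)].
    right. apply Rlsum_ext. intros y _. f_equal. rewrite pow_inv, Hr2.
    apply Rinv_mult.
Qed.

Lemma conv_double_sum a b A B N M :
  Hb d s a A -> Hb d s b B ->
  Rlsum (box d N) (fun x => Rlsum (box d M) (fun y => (wt s y * Cmod (a y) ^ 2)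
           * (wt s (vsub x y) * Cmod (b (vsub x y)) ^ 2))) <= A ^ 2 * B ^ 2.
Proof.
  intros [HA Ha] [HB Hb']. rewrite Rlsum_swap.
  apply Rle_trans with (Rlsum (box d M) (fun y => B ^ 2 * (wt s y * Cmod (a y) ^ 2))).
  - apply Rlsum_le. intros y Hy. apply box_length in Hy.
    rewrite Rlsum_scal, Rmult_comm. apply Rmult_le_compat_r.
    + apply Rmult_le_pos; [left; apply wt_pos|apply pow2_ge_0].
    + rewrite <- (Rlsum_map (fun x => vsub x y) _ (fun z => wt s z * Cmod (b z) ^ 2)).
      apply Rlsum_le_of_box with d; auto.
      * intros. apply Rmult_le_pos; [left; apply wt_pos|apply pow2_ge_0].
      * apply NoDup_map_NoDup_ForallPairs; [|apply NoDup_box].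
        intros x z Hx Hz. apply box_length in Hx. apply box_length in Hz.
        clear - Hx Hy Hz. revert d y z Hx Hy Hz.
        induction x as [|p x IH]; intros d [|q y] [|r z] Hx Hy Hz; simpl in *; subst;
          try discriminate; [reflexivity|].
        rewrite !vsub_cons. intros E. injection E as E1 E2. f_equal; [lia|].
        apply (IH (length x) y z); auto.
      * intros x Hx. apply in_map_iff in Hx. destruct Hx as [z [<- Hz]].
        apply box_length in Hz. now apply vsub_length.
  - rewrite Rlsum_scal, Rmult_comm. apply Rmult_le_compat_r; [apply pow2_ge_0|auto].
Qed.

Lemma conv_summable a b A B x :
  Hb d s a A -> Hb d s b B -> length x = d -> Csummable d (fun y => a y * b (vsub x y))%C.
Proof.
  intros Ha Hb' Hx. pose proof (wt_pos s x).
  exists (1 + K * (A ^ 2 * B ^ 2) * / wt s x). intros N.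
  rewrite (Rlsum_ext _ _ (fun y => Cmod (a y) * Cmod (b (vsub x y)))).
  2:{ intros. rewrite Rabs_pos_eq by apply Cmod_ge_0. apply Cmod_mult. }
  assert (H1 := conv_CS a b x N Hx).
  set (t := Rlsum (box d N) (fun y => Cmod (a y) * Cmod (b (vsub x y)))) in *.
  (* Retaining the single outer frequency [x] in the double sum turns that bound into one for this
     [x]. *)
  destruct (in_some_box d x Hx) as [N' HN'].
  assert (H2 : Rlsum (box d N) (fun y => (wt s y * Cmod (a y) ^ 2)
           * (wt s (vsub x y) * Cmod (b (vsub x y)) ^ 2)) <= A ^ 2 * B ^ 2).
  { eapply Rle_trans; [|apply (conv_double_sum a b A B N' N Ha Hb')].
    set (g := fun x => Rlsum (box d N) (fun y => (wt s y * Cmod (a y) ^ 2)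
           * (wt s (vsub x y) * Cmod (b (vsub x y)) ^ 2))).
    change (g x <= Rlsum (box d N') g).
    replace (g x) with (Rlsum (x :: nil) g) by (simpl; ring).
    apply Rlsum_incl.
    - repeat constructor; simpl; tauto.
    - intros y [<-|[]]; assumption.
    - intros y _. apply Rlsum_ge0. intros. apply Rmult_le_pos; apply Rmult_le_pos;
        (left; apply wt_pos) || apply pow2_ge_0. }
  assert (H3 : wt s x * t ^ 2 <= K * (A ^ 2 * B ^ 2)) by nra.
  (* Only some finite bound is wanted, so the estimate on [t ^ 2] is used without extracting a
     root. *)
  assert (t <= 1 + t ^ 2) by (pose proof (pow2_ge_0 (t - 1)); nra).
  eapply Rle_trans; [exact H0|]. apply Rplus_le_compat_l.
  apply Rmult_le_reg_l with (wt s x); [assumption|].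
  eapply Rle_trans; [exact H3|]. right. field. lra.
Qed.

Lemma Hb_conv a b A B :
  Hb d s a A -> Hb d s b B -> Hb d s (conv d a b) (sqrt K * A * B).
Proof.
  intros Ha Hb'. pose proof (sqrt_pos K).
  split; [apply Rmult_le_pos; [apply Rmult_le_pos|]; [assumption|apply Ha|apply Hb']|].
  intros N.
  (* The outer box stays fixed while the inner one grows; every estimate below is uniform in
     both. *)
  assert (L : is_lim_seq (fun M => Rlsum (box d N) (fun x =>
      wt s x * Cmod (Clsum (box d M) (fun y => a y * b (vsub x y))%C) ^ 2))
    (Rlsum (box d N) (fun x => wt s x * Cmod (conv d a b x) ^ 2))).
  { apply (is_lim_seq_Rlsum _
      (fun M x => wt s x * Cmod (Clsum (box d M) (fun y => a y * b (vsub x y))%C) ^ 2)).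
    intros x Hx. apply box_length in Hx.
    apply (is_lim_seq_scal_l _ (wt s x) (Cmod (conv d a b x) ^ 2)).
    apply zsum_lim_sqr. eapply conv_summable; eassumption. }
  refine (is_lim_seq_le _ _ _ ((sqrt K * A * B) ^ 2) _ L (is_lim_seq_const _)).
  intros M.
  apply Rle_trans with (Rlsum (box d N) (fun x => K * Rlsum (box d M) (fun y => (wt s y * Cmod (a y) ^ 2)
           * (wt s (vsub x y) * Cmod (b (vsub x y)) ^ 2)))).
  - apply Rlsum_le. intros x Hx. apply box_length in Hx.
    eapply Rle_trans; [|apply (conv_CS a b x M Hx)].
    apply Rmult_le_compat_l; [left; apply wt_pos|]. apply pow_incr.
    split; [apply Cmod_ge_0|]. eapply Rle_trans; [apply Cmod_Clsum|].
    right. apply Rlsum_ext. intros. apply Cmod_mult.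
  - rewrite Rlsum_scal, !Rpow_mult_distr, pow2_sqrt, Rmult_assoc by lra.
    apply Rmult_le_compat_l; [lra|]. now apply conv_double_sum.
Qed.

End Algebra.

(** All that later arguments use of [s > d/2]. The summability clause is what gives access to the
    ring laws of [conv]. *)
Definition algebra (d : nat) (s k : R) : Prop :=
  0 <= k /\
  (forall a b A B, Hb d s a A -> Hb d s b B -> Hb d s (conv d a b) (k * A * B)) /\
  (forall a b A B x, Hb d s a A -> Hb d s b B -> length x = d ->
     Csummable d (fun y => a y * b (vsub x y))%C).

(** Every larger constant is allowed, so that the exponents [gamma] and [gamma + 2] can share
    one. *)
Lemma algebra_exists d s :
  (1 <= d)%nat -> INR d / 2 < s -> exists k, forall k', k <= k' -> algebra d s k'.
Proof.
  intros Hd Hs. destruct (kernel_bound d s Hd Hs) as [K [HK HB]].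
  exists (sqrt K). intros k' Hk. pose proof (sqrt_pos K). split; [lra|split].
  - intros a b A B Ha Hb'. eapply Hb_le; [|apply (Hb_conv d s K HK HB a b A B); assumption].
    apply Rmult_le_compat_r; [apply Hb'|]. apply Rmult_le_compat_r; [apply Ha|assumption].
  - intros a b A B x Ha Hb' Hx. eapply conv_summable; eassumption.
Qed.

Definition inH (d : nat) (s : R) (a : Four) : Prop := exists A, Hb d s a A.

(** The majorant of [a]: same norms, nonnegative coefficients. Convolutions of majorants dominate
    multilinear forms whose symbols are bounded in modulus. *)
Definition absF (a : Four) : Four := fun x => RtoC (Cmod (a x)).

Lemma Cmod_absF a x : Cmod (absF a x) = Cmod (a x).
Proof. unfold absF. rewrite Cmod_R. apply Rabs_pos_eq, Cmod_ge_0. Qed.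

Lemma Hb_absF d s a A : Hb d s a A -> Hb d s (absF a) A.
Proof. apply Hb_dom. intros; rewrite Cmod_absF; lra. Qed.

Lemma inH_absF d s a : inH d s a -> inH d s (absF a).
Proof. intros [A HA]. exists A. now apply Hb_absF. Qed.

Lemma inH_conj d s a : inH d s a -> inH d s (conjF a).
Proof. intros [A HA]. exists A. now apply Hb_conj. Qed.

Lemma Hb_sub d s a b A B : Hb d s a A -> Hb d s b B -> Hb d s (Fsub a b) (A + B).
Proof.
  intros HA HB. apply (Hb_ext d s _ (fun x => a x + (- (1)) * b x)%C).
  - intros; unfold Fsub; ring.
  - apply Hb_plus; [assumption|].
    eapply Hb_le; [|apply Hb_scal; eassumption]. rewrite Cmod_opp, Cmod_1. lra.
Qed.

Lemma conv_ext d a a' b b' x :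
  length x = d -> (forall y, length y = d -> a y = a' y) ->
  (forall y, length y = d -> b y = b' y) -> conv d a b x = conv d a' b' x.
Proof.
  intros Hx Ha Hb'. apply zsum_ext. intros y Hy.
  rewrite Ha, Hb'; auto. now apply vsub_length.
Qed.

Section ConvRing.
Variables (d : nat) (s k : R).
Hypothesis alg : algebra d s k.

Lemma conv_inH a b : inH d s a -> inH d s b -> inH d s (conv d a b).
Proof.
  intros [A HA] [B HB]. exists (k * A * B). now apply (proj1 (proj2 alg)).
Qed.

Lemma conv_sm a b x :
  inH d s a -> inH d s b -> length x = d -> Csummable d (fun y => a y * b (vsub x y))%C.
Proof. intros [A HA] [B HB] Hx. eapply (proj2 (proj2 alg)); eassumption. Qed.

Lemma conv_sub_l a a' b x :
  inH d s a -> inH d s a' -> inH d s b -> length x = d ->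
  (conv d a b x - conv d a' b x)%C = conv d (Fsub a a') b x.
Proof.
  intros Ha Ha' Hb' Hx. unfold conv.
  rewrite <- zsum_minus by (now apply conv_sm).
  apply zsum_ext. intros; unfold Fsub; ring.
Qed.

Lemma conv_sub_r a b b' x :
  inH d s a -> inH d s b -> inH d s b' -> length x = d ->
  (conv d a b x - conv d a b' x)%C = conv d a (Fsub b b') x.
Proof.
  intros Ha Ha' Hb' Hx. unfold conv.
  rewrite <- zsum_minus by (now apply conv_sm).
  apply zsum_ext. intros; unfold Fsub; ring.
Qed.

Lemma conv_scal_l c a b x :
  inH d s a -> inH d s b -> length x = d ->
  conv d (fun y => c * a y)%C b x = (c * conv d a b x)%C.
Proof.
  intros Ha Hb' Hx. unfold conv. rewrite <- zsum_scal by (now apply conv_sm).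
  apply zsum_ext. intros; ring.
Qed.

Lemma conv_scal_r c a b x :
  inH d s a -> inH d s b -> length x = d ->
  conv d a (fun y => c * b y)%C x = (c * conv d a b x)%C.
Proof.
  intros Ha Hb' Hx. unfold conv. rewrite <- zsum_scal by (now apply conv_sm).
  apply zsum_ext. intros; ring.
Qed.

Lemma conv_comm a b x :
  inH d s a -> inH d s b -> length x = d -> conv d a b x = conv d b a x.
Proof.
  intros Ha Hb' Hx. unfold conv.
  rewrite <- (zsum_reindex d (vsub x) (fun y => b y * a (vsub x y))%C).
  - apply zsum_ext. intros y Hy. rewrite (vsub_vsub d) by assumption. ring.
  - intros y Hy. now apply vsub_length.
  - intros y Hy. now apply (vsub_vsub d).
  - now apply conv_sm.
Qed.

Lemma conjF_conv a b x :
  inH d s a -> inH d s b -> length x = d ->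
  conjF (conv d a b) x = conv d (conjF a) (conjF b) x.
Proof.
  intros Ha Hb' Hx. unfold conjF at 1. unfold conv.
  rewrite <- zsum_conj.
  rewrite <- (zsum_reindex d vneg (fun y => conjF a y * conjF b (vsub x y))%C).
  - apply zsum_ext. intros y Hy. unfold conjF. rewrite vneg_vneg.
    rewrite (vneg_vsub d) by (auto using vneg_length). rewrite vneg_vneg.
    unfold Cconj, Cmult; simpl. f_equal; ring.
  - apply vneg_length.
  - intros; apply vneg_vneg.
  - apply conv_sm; auto using inH_conj.
Qed.

(** * Triple convolutions *)

Lemma conv3_summable a b c x :
  inH d s a -> inH d s b -> inH d s c -> length x = d ->
  Csummable2 d (fun y z => a y * (b z * c (vsub (vsub x y) z)))%C.
Proof.
  intros Ha Hb' Hc Hx.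
  assert (Hbc : inH d s (conv d (absF b) (absF c))) by (apply conv_inH; now apply inH_absF).
  destruct (conv_sm a _ x Ha Hbc Hx) as [B HB].
  exists B. intros N M. eapply Rle_trans; [|apply (HB N)].
  apply Rlsum_le. intros y Hy. apply box_length in Hy.
  rewrite (Rabs_pos_eq (Cmod _)) by apply Cmod_ge_0. rewrite Cmod_mult.
  rewrite (Rlsum_ext _ _ (fun z => Cmod (a y) * Cmod (b z * c (vsub (vsub x y) z))%C)).
  2:{ intros. rewrite Rabs_pos_eq by apply Cmod_ge_0. apply Cmod_mult. }
  rewrite Rlsum_scal. apply Rmult_le_compat_l; [apply Cmod_ge_0|].
  unfold conv.
  rewrite (zsum_ext d _ (fun z => RtoC (Cmod (b z * c (vsub (vsub x y) z))%C))).
  2:{ intros. unfold absF. now rewrite <- RtoC_mult, Cmod_mult. }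
  rewrite zsum_RtoC, Cmod_R.
  assert (Hs := conv_sm b c (vsub x y) Hb' Hc (vsub_length _ _ _ Hx Hy)).
  eapply Rle_trans; [|apply Rle_abs].
  apply Rlsum_box_le_Rzsum; [intros; apply Cmod_ge_0|exact Hs].
Qed.

Lemma conv3_eq a b c x :
  inH d s b -> inH d s c -> length x = d ->
  conv d a (conv d b c) x
    = zsum d (fun y => zsum d (fun z => a y * (b z * c (vsub (vsub x y) z)))%C).
Proof.
  intros Hb' Hc Hx. unfold conv at 1. apply zsum_ext. intros y Hy.
  unfold conv. rewrite <- zsum_scal; [reflexivity|]. apply conv_sm; auto using vsub_length.
Qed.

(** Fubini for the double sum defining a triple product. With commutativity this takes the place of
    associativity when factors of right-nested products are permuted. *)
Lemma conv_left_comm a b c x :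
  inH d s a -> inH d s b -> inH d s c -> length x = d ->
  conv d a (conv d b c) x = conv d b (conv d a c) x.
Proof.
  intros Ha Hb' Hc Hx. rewrite !conv3_eq by assumption.
  rewrite zsum_swap by now apply conv3_summable.
  apply zsum_ext. intros y Hy. apply zsum_ext. intros z Hz.
  rewrite (vsub_comm d x z y) by assumption. ring.
Qed.

(** The passage from symbols to norms: a pointwise bound on a trilinear symbol becomes a
    coefficientwise bound by a product of majorants, to which the algebra property applies. *)
Lemma conv3_dom a b c x p :
  inH d s a -> inH d s b -> inH d s c -> length x = d ->
  (forall y z, length y = d -> length z = d ->
    Cmod (p y z) <= Cmod (a y * (b z * c (vsub (vsub x y) z)))%C) ->
  Cmod (zsum d (fun y => zsum d (p y))) <= Cmod (conv d (absF a) (conv d (absF b) (absF c)) x).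
Proof.
  intros Ha Hb' Hc Hx H. assert (S2 := conv3_summable a b c x Ha Hb' Hc Hx).
  rewrite conv3_eq by (auto using inH_absF).
  rewrite (zsum_ext d (fun y => zsum d (fun z => absF a y * _)%C)
    (fun y => RtoC (Rzsum d (fun z => Cmod (a y * (b z * c (vsub (vsub x y) z)))%C)))).
  2:{ intros y Hy. rewrite <- zsum_RtoC. apply zsum_ext. intros z Hz.
      unfold absF. now rewrite <- !RtoC_mult, !Cmod_mult. }
  rewrite zsum_RtoC, Cmod_R. eapply Rle_trans; [|apply Rle_abs].
  apply Cmod_zsum.
  - intros y Hy. apply Cmod_zsum; [now auto|]. now apply (Csummable2_inner d _ y S2).
  - apply (summable2_outer d _ S2).
Qed.

Lemma Hb_conv3 a b c A B C :
  Hb d s a A -> Hb d s b B -> Hb d s c C ->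
  Hb d s (conv d a (conv d b c)) (k ^ 2 * (A * B * C)).
Proof.
  intros Ha Hb' Hc. destruct alg as [_ [Hk _]].
  eapply Hb_le; [|apply Hk; [eassumption|apply Hk; eassumption]]. right; ring.
Qed.

Lemma conv3_telescope a b c a' b' c' x :
  inH d s a -> inH d s b -> inH d s c -> inH d s a' -> inH d s b' -> inH d s c' ->
  length x = d ->
  (conv d a (conv d b c) x - conv d a' (conv d b' c') x)%C =
  (conv d (Fsub a a') (conv d b c) x + conv d a' (conv d (Fsub b b') c) x
     + conv d a' (conv d b' (Fsub c c')) x)%C.
Proof.
  intros Ia Ib Ic Ia' Ib' Ic' Hx.
  rewrite <- conv_sub_l by (auto using conv_inH).
  rewrite <- (conv_ext d a' a' (Fsub (conv d b c) (conv d b' c)) (conv d (Fsub b b') c))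
    by (auto; intros; now apply conv_sub_l).
  rewrite <- (conv_ext d a' a' (Fsub (conv d b' c) (conv d b' c')) (conv d b' (Fsub c c')))
    by (auto; intros; now apply conv_sub_r).
  rewrite <- !conv_sub_r by (auto using conv_inH). ring.
Qed.

Lemma conv3_lip a b c a' b' c' A B C A' B' C' Da Db Dc :
  Hb d s a A -> Hb d s b B -> Hb d s c C -> Hb d s a' A' -> Hb d s b' B' -> Hb d s c' C' ->
  Hb d s (Fsub a a') Da -> Hb d s (Fsub b b') Db -> Hb d s (Fsub c c') Dc ->
  Hb d s (Fsub (conv d a (conv d b c)) (conv d a' (conv d b' c')))
    (k ^ 2 * (Da * B * C + A' * Db * C + A' * B' * Dc)).
Proof.
  intros Ha Hb1 Hc Ha' Hb1' Hc' HDa HDb HDc.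
  eapply Hb_ext.
  - intros x Hx. unfold Fsub at 1. apply conv3_telescope; (eexists; eassumption) || assumption.
  - eapply Hb_le; [|apply Hb_plus; [apply Hb_plus|]; apply Hb_conv3; eassumption].
    right; ring.
Qed.

(** Substituting the cubic term into any one slot of the cubic form gives [|a|^4 a]. Here it sits in
    the conjugated slot, where conjugation turns it into one factor [a] and two factors [conjF a];
    the two unconjugated slots are treated below. *)
Lemma quintic_conj a x :
  inH d s a -> length x = d ->
  conv d (conjF (cubic d a)) (conv d a a) x = quintic d a x.
Proof.
  intros Ha Hx. unfold cubic, quintic.
  assert (Hc := inH_conj d s a Ha).
  assert (Haa := conv_inH a a Ha Ha).
  assert (E1 : forall y, length y = d ->
    conjF (conv d (conjF a) (conv d a a)) y = conv d a (conv d (conjF a) (conjF a)) y).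
  { intros y Hy. rewrite conjF_conv by assumption.
    apply conv_ext; [assumption| |].
    - intros z _. unfold conjF. rewrite vneg_vneg. apply Cconj_conj.
    - intros z Hz. now apply conjF_conv. }
  rewrite (conv_ext d _ (conv d a (conv d (conjF a) (conjF a))) _ (conv d a a)) by auto.
  assert (Hcc := conv_inH _ _ Hc Hc).
  rewrite conv_comm by (auto using conv_inH).
  rewrite conv_left_comm by auto.
  rewrite (conv_ext d a a _ (conv d (conjF a) (conv d (conjF a) (conv d a a)))); auto.
  - rewrite conv_left_comm by (auto using conv_inH).
    apply conv_ext; auto. intros y Hy. apply conv_left_comm; auto.
  - intros y Hy. rewrite conv_left_comm by auto.
    apply conv_ext; auto. intros z Hz. now apply conv_comm.
Qed.

Lemma quintic_right a x :
  inH d s a -> length x = d ->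
  conv d (conjF a) (conv d a (cubic d a)) x = quintic d a x.
Proof.
  intros Ha Hx. unfold cubic, quintic.
  assert (Hc := inH_conj d s a Ha).
  apply conv_ext; auto. intros y Hy. apply conv_left_comm; auto using conv_inH.
Qed.

Lemma quintic_mid a x :
  inH d s a -> length x = d ->
  conv d (conjF a) (conv d (cubic d a) a) x = quintic d a x.
Proof.
  intros Ha Hx. rewrite <- quintic_right by assumption.
  apply conv_ext; auto. intros y Hy. apply conv_comm; auto.
  unfold cubic. auto using conv_inH, inH_conj.
Qed.

End ConvRing.

(** * The free flow *)

Definition cis (t : R) : C := (cos t, sin t).

Lemma cis_plus s t : cis (s + t) = (cis s * cis t)%C.
Proof. unfold cis, Cmult; simpl. rewrite cos_plus, sin_plus. f_equal; ring. Qed.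

Lemma Cmod_cis t : Cmod (cis t) = 1.
Proof.
  unfold cis, Cmod; simpl. rewrite !Rmult_1_r. pose proof (sin2_cos2 t). unfold Rsqr in *.
  replace (cos t * cos t + sin t * sin t) with 1 by lra. apply sqrt_1.
Qed.

Lemma cis_0 : cis 0 = 1%C.
Proof. unfold cis. now rewrite cos_0, sin_0. Qed.

Lemma Cexp_imag t : Cexp (Ci * RtoC t)%C = cis t.
Proof.
  unfold Cexp, cis, Ci, RtoC, Cmult; simpl.
  replace (0 * t - 1 * 0) with 0 by ring. replace (0 * 0 + 1 * t) with t by ring.
  rewrite exp_0. f_equal; ring.
Qed.

Lemma Sch_cis t x : Sch t x = cis (- (t * nrm2 x)).
Proof.
  unfold Sch. rewrite <- Cexp_imag. f_equal.
  unfold Ci, RtoC, Cmult, Copp; simpl. f_equal; ring.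
Qed.

Lemma Cmod_Sch t x : Cmod (Sch t x) = 1.
Proof. rewrite Sch_cis. apply Cmod_cis. Qed.

Lemma Sch_plus s t x : Sch (s + t) x = (Sch s x * Sch t x)%C.
Proof. rewrite !Sch_cis, <- cis_plus. f_equal; ring. Qed.

Lemma Sch_0 x : Sch 0 x = 1%C.
Proof. rewrite Sch_cis, Rmult_0_l, Ropp_0. apply cis_0. Qed.

Lemma Sch_inv t x : (Sch t x * Sch (- t) x)%C = 1%C.
Proof. rewrite <- Sch_plus, Rplus_opp_r. apply Sch_0. Qed.

Lemma Cconj_cis t : Cconj (cis t) = cis (- t).
Proof. unfold cis, Cconj; simpl. now rewrite cos_neg, sin_neg. Qed.

Lemma conjF_Sch t a x : conjF (mult (Sch t) a) x = mult (Sch (- t)) (conjF a) x.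
Proof.
  unfold conjF, mult. rewrite Cmult_conj, !Sch_cis, Cconj_cis, nrm2_vneg.
  f_equal. f_equal. ring.
Qed.

(** * Taylor bounds for the imaginary exponential *)

Lemma one_minus_cos t : 0 <= 1 - cos t <= t ^ 2 / 2.
Proof.
  split; [pose proof (COS_bound t); lra|].
  replace t with (2 * (t / 2)) at 1 by field. rewrite cos_2a_sin.
  assert (sin (t / 2) ^ 2 <= (t / 2) ^ 2).
  { rewrite <- (pow2_abs (sin _)), <- (pow2_abs (t / 2)). apply pow_incr.
    split; [apply Rabs_pos|].
    destruct (Rle_dec 0 (t / 2)) as [H|H].
    - rewrite (Rabs_pos_eq (t / 2)) by assumption. apply Rabs_le.
      destruct (Req_dec (t / 2) 0) as [->|]; [rewrite sin_0; lra|].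
      pose proof (sin_lt_x (t / 2) ltac:(lra)).
      destruct (Rle_dec (t / 2) PI).
      + pose proof (sin_ge_0 (t / 2) H ltac:(assumption)). lra.
      + pose proof (SIN_bound (t / 2)). pose proof PI2_1. lra.
    - rewrite (Rabs_left (t / 2)) by lra. rewrite <- Rabs_Ropp, <- sin_neg. apply Rabs_le.
      pose proof (sin_lt_x (- (t / 2)) ltac:(lra)).
      destruct (Rle_dec (- (t / 2)) PI).
      + pose proof (sin_ge_0 (- (t / 2)) ltac:(lra) ltac:(assumption)). lra.
      + pose proof (SIN_bound (- (t / 2))). pose proof PI2_1. lra. }
  simpl in *. lra.
Qed.

Lemma cis_minus_1 t : Cmod (cis t - 1)%C <= Rabs t.
Proof.
  apply Rsqr_incr_0_var; [|apply Rabs_pos]. rewrite !Rsqr_pow2, Cmod_sqr, pow2_abs.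
  unfold cis, Cminus, Cplus, Copp, RtoC; simpl fst; simpl snd.
  pose proof (one_minus_cos t). pose proof (sin2_cos2 t). unfold Rsqr in *. nra.
Qed.

(** The mean value theorem gives [sin t - t = (cos c - 1) t] with [|c| <= |t|]. A quadratic bound is
    of the same order as the one for [1 - cos t], with which it is combined. *)
Lemma Rabs_sin_minus t : Rabs (sin t - t) <= t ^ 2.
Proof.
  destruct (MVT_gen sin 0 t cos) as [c [Hc E]].
  - intros x _. apply is_derive_Reals, derivable_pt_lim_sin.
  - intros x _. apply continuity_sin.
  - rewrite sin_0, !Rminus_0_r in E. rewrite E.
    replace (cos c * t - t) with (- ((1 - cos c) * t)) by ring.
    rewrite Rabs_Ropp, Rabs_mult.
    pose proof (cis_minus_1 c) as H. pose proof (Rabs_fst_le (cis c - 1)%C) as H'.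
    unfold cis, Cminus, Cplus, Copp, RtoC in H'; simpl fst in H'.
    assert (Rabs (1 - cos c) <= Rabs t).
    { rewrite Rabs_minus_sym. change (cos c - 1) with (cos c + - (1)).
      eapply Rle_trans; [exact H'|]. eapply Rle_trans; [exact H|].
      unfold Rmin, Rmax in Hc. destruct (Rle_dec 0 t).
      - rewrite !Rabs_pos_eq; lra.
      - rewrite !Rabs_left1; lra. }
    rewrite <- (pow2_abs t). pose proof (Rabs_pos t). simpl. nra.
Qed.

Lemma cis_taylor t : Cmod (cis t - 1 - Ci * RtoC t)%C <= 2 * t ^ 2.
Proof.
  apply Rsqr_incr_0_var; [|pose proof (pow2_ge_0 t); lra].
  rewrite !Rsqr_pow2, Cmod_sqr.
  unfold cis, Ci, Cminus, Cplus, Copp, Cmult, RtoC; simpl fst; simpl snd.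
  pose proof (one_minus_cos t) as H1. pose proof (Rabs_sin_minus t) as H2.
  apply Rabs_le_between in H2.
  replace (cos t + - (1) + - (0 * t - 1 * 0)) with (- (1 - cos t)) by ring.
  replace (sin t + -0 + - (0 * 0 + 1 * t)) with (sin t - t) by ring.
  pose proof (pow2_ge_0 t).
  revert H1 H2 H. generalize (t ^ 2), (1 - cos t), (sin t - t). intros p q r H1 H2 H. nra.
Qed.

Lemma Sch_minus_1 t x : Cmod (Sch t x - 1)%C <= Rabs t * (1 + nrm2 x).
Proof.
  rewrite Sch_cis. eapply Rle_trans; [apply cis_minus_1|].
  rewrite Rabs_Ropp, Rabs_mult, (Rabs_pos_eq (nrm2 x)) by apply nrm2_ge0.
  pose proof (Rabs_pos t). nra.
Qed.

Lemma Hb_mult d s m c a A :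
  0 <= c -> (forall x, length x = d -> Cmod (m x) <= c) -> Hb d s a A ->
  Hb d s (mult m a) (c * A).
Proof.
  intros Hc Hm. apply Hb_bound; [assumption|]. intros x Hx. unfold mult. rewrite Cmod_mult.
  apply Rmult_le_compat_r; [apply Cmod_ge_0|auto].
Qed.

Lemma Hb_Sch d s t a A : Hb d s a A -> Hb d s (mult (Sch t) a) A.
Proof.
  intros HA. eapply Hb_le; [|apply (Hb_mult d s (Sch t) 1); [lra| |exact HA]]; [lra|].
  intros. rewrite Cmod_Sch. lra.
Qed.

Lemma Hb_Sch_sub d s t a A :
  Hb d (s + 2) a A -> Hb d s (Fsub (mult (Sch t) a) a) (Rabs t * A).
Proof.
  apply Hb_gain; [apply Rabs_pos|]. intros x Hx. unfold Fsub, mult.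
  replace (Sch t x * a x - a x)%C with ((Sch t x - 1) * a x)%C by ring.
  rewrite Cmod_mult. apply Rmult_le_compat_r; [apply Cmod_ge_0|apply Sch_minus_1].
Qed.

Lemma Hb_conj_sub d s a b A : Hb d s (Fsub a b) A -> Hb d s (Fsub (conjF a) (conjF b)) A.
Proof.
  intros H. apply (Hb_ext d s _ (conjF (Fsub a b))); [|now apply Hb_conj].
  intros x _. unfold Fsub, conjF. now rewrite Cminus_conj.
Qed.

Lemma Hb_sub_trans d s a b c A B :
  Hb d s (Fsub a b) A -> Hb d s (Fsub b c) B -> Hb d s (Fsub a c) (A + B).
Proof.
  intros HA HB. apply (Hb_ext d s _ (fun x => Fsub a b x + Fsub b c x)%C).
  - intros. unfold Fsub. ring.
  - now apply Hb_plus.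
Qed.

(** The form [N_t] of the interaction picture with its three slots separated, so that increments can
    be inserted one at a time; [a] is the conjugated slot. *)
Definition Ntw (d : nat) (t : R) (a b c : Four) : Four :=
  mult (Sch (- t)) (conv d (conjF (mult (Sch t) a))
    (conv d (mult (Sch t) b) (mult (Sch t) c))).

(* Each of the four occurrences of the free flow in [Ntw] is frozen at the price of [t] and
   two derivatives. *)
Lemma Ntw_cmp d s k t a b c a' b' c' A B C A' B' C' Da Db Dc :
  algebra d s k -> algebra d (s + 2) k -> 0 <= t ->
  Hb d (s + 2) a A -> Hb d (s + 2) b B -> Hb d (s + 2) c C ->
  Hb d s a' A' -> Hb d s b' B' -> Hb d s c' C' ->
  Hb d s (Fsub a a') Da -> Hb d s (Fsub b b') Db -> Hb d s (Fsub c c') Dc ->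
  Hb d s (Fsub (Ntw d t a b c) (conv d (conjF a') (conv d b' c')))
    (k ^ 2 * (4 * t * (A * B * C) + Da * B * C + A' * Db * C + A' * B' * Dc)).
Proof.
  intros alg alg2 Ht Ha Hb1 Hc Ha' Hb1' Hc' HDa HDb HDc.
  assert (Et : Rabs t = t) by now apply Rabs_pos_eq.
  eapply Hb_le; cycle 1.
  - eapply Hb_sub_trans; [apply Hb_Sch_sub|eapply Hb_sub_trans].
    + apply (Hb_conv3 d (s + 2) k alg2); [apply Hb_conj| |]; apply Hb_Sch; eassumption.
    + eapply (conv3_lip d s k alg) with (a' := conjF a) (b' := b) (c' := c);
      [apply Hb_conj, Hb_Sch, Hb_mono; eassumption|apply Hb_Sch, Hb_mono; eassumption
      |apply Hb_Sch, Hb_mono; eassumption|apply Hb_conj, Hb_mono; eassumption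
      |apply Hb_mono; eassumption|apply Hb_mono; eassumption
      |apply Hb_conj_sub, Hb_Sch_sub; eassumption
      |apply Hb_Sch_sub; eassumption|apply Hb_Sch_sub; eassumption].
    + eapply (conv3_lip d s k alg);
      [apply Hb_conj, Hb_mono; eassumption|apply Hb_mono; eassumption
      |apply Hb_mono; eassumption|apply Hb_conj; eassumption|eassumption|eassumption
      |apply Hb_conj_sub; eassumption|eassumption|eassumption].
  - rewrite Rabs_Ropp, Et. right; ring.
Qed.

(** * Integrals of complex functions *)

Definition CInt (f : R -> C) (a b : R) (l : C) : Prop :=
  is_RInt (fun t => fst (f t)) a b (fst l) /\ is_RInt (fun t => snd (f t)) a b (snd l).

Lemma is_RInt_eq (f : R -> R) (a b l l' : R) : is_RInt f a b l -> l = l' -> is_RInt f a b l'.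
Proof. now intros H <-. Qed.

Lemma is_RInt_extR (f g : R -> R) (a b l : R) :
  (forall t, f t = g t) -> is_RInt f a b l -> is_RInt g a b l.
Proof. intros H. apply is_RInt_ext. intros; apply H. Qed.

Lemma CInt_ext f g a b l :
  (forall t, Rmin a b < t < Rmax a b -> f t = g t) -> CInt f a b l -> CInt g a b l.
Proof.
  intros H [H1 H2]. split; (eapply is_RInt_ext; [|eassumption]); intros t Ht; simpl; now rewrite (H t Ht).
Qed.

Lemma CInt_scal c f a b l : CInt f a b l -> CInt (fun t => c * f t)%C a b (c * l)%C.
Proof.
  intros [H1 H2]. unfold Cmult; split; simpl.
  - exact (is_RInt_minus _ _ _ _ _ _ (is_RInt_scal _ _ _ (fst c) _ H1) (is_RInt_scal _ _ _ (snd c) _ H2)).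
  - exact (is_RInt_plus _ _ _ _ _ _ (is_RInt_scal _ _ _ (fst c) _ H2) (is_RInt_scal _ _ _ (snd c) _ H1)).
Qed.

Lemma CInt_plus f g a b l m :
  CInt f a b l -> CInt g a b m -> CInt (fun t => f t + g t)%C a b (l + m)%C.
Proof.
  intros [H1 H2] [H3 H4]. split; simpl.
  - exact (is_RInt_plus _ _ _ _ _ _ H1 H3).
  - exact (is_RInt_plus _ _ _ _ _ _ H2 H4).
Qed.

Lemma CInt_minus f g a b l m :
  CInt f a b l -> CInt g a b m -> CInt (fun t => f t - g t)%C a b (l - m)%C.
Proof.
  intros [H1 H2] [H3 H4]. split; simpl.
  - exact (is_RInt_minus _ _ _ _ _ _ H1 H3).
  - exact (is_RInt_minus _ _ _ _ _ _ H2 H4).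
Qed.

Lemma CInt_const c a b : CInt (fun _ => c) a b (RtoC (b - a) * c)%C.
Proof.
  split; (eapply is_RInt_eq; [apply is_RInt_const|]);
    unfold scal; simpl; unfold Hierarchy.mult; simpl; ring.
Qed.

Lemma CInt_shift f a b l m :
  CInt f 0 (a + b) l -> CInt f 0 a m -> CInt (fun t => f (a + t)) 0 b (l - m)%C.
Proof.
  assert (P : forall (h : R -> R) p q, is_RInt h 0 (a + b) p -> is_RInt h 0 a q ->
    is_RInt (fun t => h (a + t)) 0 b (p - q)).
  { intros h p q Hp Hq.
    assert (H := is_RInt_Chasles _ _ _ _ _ _ (is_RInt_swap _ _ _ _ Hq) Hp).
    assert (H' : is_RInt h (1 * 0 + a) (1 * b + a) (plus (opp q) p)).
    { now replace (1 * 0 + a) with a by ring; replace (1 * b + a) with (a + b) by ring. }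
    apply is_RInt_comp_lin in H'.
    eapply is_RInt_eq; [eapply is_RInt_ext; [|exact H']|].
    - intros t _. unfold scal; simpl; unfold Hierarchy.mult; simpl. rewrite Rmult_1_l. f_equal. ring.
    - unfold plus, opp; simpl. ring. }
  intros [H1 H2] [H3 H4]. split; simpl; now apply (P (fun t => _ (f t))).
Qed.

Lemma is_RInt_Rlsum l (f : R -> list Z -> R) F a b :
  (forall x, In x l -> is_RInt (fun t => f t x) a b (F x)) ->
  is_RInt (fun t => Rlsum l (f t)) a b (Rlsum l F).
Proof.
  induction l as [|y l IH]; intros H; simpl.
  - eapply is_RInt_eq; [apply is_RInt_const|].
    unfold scal; simpl; unfold Hierarchy.mult; simpl; ring.
  - apply (is_RInt_plus (fun t => f t y)); [apply H; now left|]. apply IH; intros; apply H; now right.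
Qed.

(* Minkowski's inequality by duality: the integral is paired with itself, so that only
   linear functionals of the integrand are ever integrated. *)
Lemma Hb_int d s (f : R -> Four) F T B :
  0 <= T -> 0 <= B ->
  (forall x, length x = d -> CInt (fun t => f t x) 0 T (F x)) ->
  (forall t, 0 <= t <= T -> Hb d s (f t) B) -> Hb d s F (T * B).
Proof.
  intros HT HB HF Hf. split; [now apply Rmult_le_pos|]. intros N.
  set (Q := Rlsum (box d N) (fun x => wt s x * Cmod (F x) ^ 2)).
  assert (HQ : 0 <= Q) by apply wt_sum_ge0.
  set (g := fun t => Rlsum (box d N) (fun x => wt s x * fst (F x) * fst (f t x)
                                            + wt s x * snd (F x) * snd (f t x))).
  assert (Hg : is_RInt g 0 T Q).
  { eapply is_RInt_eq; [apply (is_RInt_Rlsum _ (fun t x => wt s x * fst (F x) * fst (f t x)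
                                            + wt s x * snd (F x) * snd (f t x)))|].
    - intros x Hx. apply box_length in Hx. destruct (HF x Hx) as [H1 H2].
      apply (is_RInt_plus _ _ _ _ _ _ (is_RInt_scal _ _ _ (wt s x * fst (F x)) _ H1)
               (is_RInt_scal _ _ _ (wt s x * snd (F x)) _ H2)).
    - apply Rlsum_ext. intros x _. rewrite Cmod_sqr.
      unfold plus, scal; simpl; unfold Hierarchy.mult; simpl. ring. }
  assert (Hle : forall t, 0 <= t <= T -> g t <= sqrt Q * B).
  { intros t Ht. destruct (Hf t Ht) as [_ Hft]. specialize (Hft N).
    apply Rle_trans with (Rlsum (box d N) (fun x => wt s x * (Cmod (F x) * Cmod (f t x)))).
    - apply Rlsum_le. intros x _. rewrite !Rmult_assoc, <- Rmult_plus_distr_l.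
      apply Rmult_le_compat_l; [left; apply wt_pos|].
      rewrite <- Cmod_conj, <- Cmod_mult.
      eapply Rle_trans; [|eapply Rle_trans; [apply Rle_abs|apply Rabs_fst_le]].
      unfold Cconj, Cmult; simpl. right; ring.
    - assert (CS := wt_CS (box d N) s F (f t)). fold Q in CS.
      set (P := Rlsum (box d N) (fun x => wt s x * (Cmod (F x) * Cmod (f t x)))) in *.
      apply Rnot_lt_le. intros H. pose proof (sqrt_pos Q).
      assert (P ^ 2 <= Q * B ^ 2) by (eapply Rle_trans; [exact CS|now apply Rmult_le_compat_l]).
      rewrite <- (sqrt_sqrt Q HQ) in H1.
      assert (0 <= sqrt Q * B) by now apply Rmult_le_pos. nra. }
  assert (HI : Q <= T * (sqrt Q * B)).
  { eapply Rle_trans; [apply (is_RInt_le g (fun _ => sqrt Q * B) 0 T Q _ HT Hg (is_RInt_const _ _ _))|].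
    - intros; apply Hle; lra.
    - unfold scal; simpl; unfold Hierarchy.mult; simpl. right; ring. }
  pose proof (sqrt_pos Q). pose proof (sqrt_sqrt Q HQ).
  assert (0 <= T * B) by now apply Rmult_le_pos.
  destruct (Req_dec (sqrt Q) 0) as [E|E].
  - rewrite <- H0, E. nra.
  - assert (sqrt Q <= T * B).
    { apply Rmult_le_reg_l with (sqrt Q); [lra|]. rewrite H0. lra. }
    rewrite <- H0. nra.
Qed.

(** Weierstrass' test: the summable majorant [g] makes the box sums converge uniformly in time, so
    integral and sum can be exchanged. *)
Lemma is_RInt_Rzsum d (f : R -> list Z -> R) F g T :
  0 <= T ->
  (forall x, length x = d -> is_RInt (fun t => f t x) 0 T (F x)) ->
  (forall t x, 0 <= t <= T -> length x = d -> Rabs (f t x) <= g x) -> summable d g ->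
  is_RInt (fun t => Rzsum d (f t)) 0 T (Rzsum d F).
Proof.
  intros HT HF Hb' Hg.
  (* Uniform convergence is demanded on the whole line but domination holds on [[0, T]] only;
     clamping the time extends it without changing the integral. *)
  set (cl := fun t => Rmax 0 (Rmin t T)).
  assert (Hcl : forall t, 0 <= cl t <= T).
  { intros t. unfold cl, Rmax, Rmin. repeat destruct Rle_dec; lra. }
  assert (Hcl' : forall t, Rmin 0 T < t < Rmax 0 T -> cl t = t).
  { intros t. rewrite Rmin_left, Rmax_right by assumption. intros.
    unfold cl, Rmax, Rmin. repeat destruct Rle_dec; lra. }
  destruct (filterlim_RInt (V := R_CompleteNormedModule)
    (fun N t => Rlsum (box d N) (f (cl t))) 0 T eventually _
    (fun t => Rzsum d (f (cl t))) (fun N => Rlsum (box d N) F)) as [If [H1 H2]].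
  - intros N. apply is_RInt_ext with (fun t => Rlsum (box d N) (f t)).
    + intros t Ht. now rewrite Hcl'.
    + apply is_RInt_Rlsum. intros x Hx. apply HF. now apply box_length in Hx.
  - apply filterlim_locally. intros eps.
    assert (L := Rzsum_lim d g Hg). apply is_lim_seq_spec in L. destruct (L eps) as [N HN].
    exists N. intros n Hn t. change (Rabs (Rlsum (box d n) (f (cl t)) - Rzsum d (f (cl t))) < eps).
    rewrite Rabs_minus_sym.
    eapply Rle_lt_trans; [apply (Rzsum_tail d _ g n)|].
    + intros x Hx. now apply Hb'.
    + assumption.
    + specialize (HN n Hn). apply Rabs_lt_between in HN. lra.
  - rewrite (Rzsum_unique d F If) by exact H1.
    eapply is_RInt_ext; [|exact H2]. intros t Ht. simpl. now rewrite Hcl'.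
Qed.

Lemma CInt_conv d (m : R -> list Z -> C) mbar a b x T :
  0 <= T -> length x = d ->
  (forall y, length y = d -> CInt (fun t => m t y) 0 T (mbar y)) ->
  (forall t y, 0 <= t <= T -> Cmod (m t y) <= 1) ->
  Csummable d (fun y => a y * b (vsub x y))%C ->
  CInt (fun t => conv d (mult (m t) a) b x) 0 T (conv d (mult mbar a) b x).
Proof.
  intros HT Hx Hm Hb1 Hs.
  assert (I : forall y, length y = d ->
    CInt (fun t => mult (m t) a y * b (vsub x y))%C 0 T (mult mbar a y * b (vsub x y))%C).
  { intros y Hy.
    assert (H := CInt_scal (a y * b (vsub x y))%C _ _ _ _ (Hm y Hy)).
    unfold mult. replace (mbar y * a y * b (vsub x y))%C with (a y * b (vsub x y) * mbar y)%C by ring.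
    eapply CInt_ext; [|exact H]. intros t _. simpl. ring. }
  assert (D : forall t y, 0 <= t <= T ->
    Cmod (mult (m t) a y * b (vsub x y))%C <= Cmod (a y * b (vsub x y))%C).
  { intros t y Ht. unfold mult. rewrite <- Cmult_assoc, Cmod_mult.
    pose proof (Hb1 t y Ht). pose proof (Cmod_ge_0 (a y * b (vsub x y))%C). nra. }
  unfold conv. split.
  - rewrite zsum_pair. simpl fst.
    eapply is_RInt_ext; [|apply (is_RInt_Rzsum d (fun t y => fst (mult (m t) a y * b (vsub x y))%C)
      (fun y => fst (mult mbar a y * b (vsub x y))%C)
      (fun y => Cmod (a y * b (vsub x y))%C)); [assumption| | |exact Hs]].
    + intros t _. exact (eq_sym (f_equal fst (zsum_pair d _))).
    + intros y Hy. apply (I y Hy).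
    + intros t y Ht Hy. eapply Rle_trans; [apply Rabs_fst_le|now apply D].
  - rewrite zsum_pair. simpl snd.
    eapply is_RInt_ext; [|apply (is_RInt_Rzsum d (fun t y => snd (mult (m t) a y * b (vsub x y))%C)
      (fun y => snd (mult mbar a y * b (vsub x y))%C)
      (fun y => Cmod (a y * b (vsub x y))%C)); [assumption| | |exact Hs]].
    + intros t _. exact (eq_sym (f_equal snd (zsum_pair d _))).
    + intros y Hy. apply (I y Hy).
    + intros t y Ht Hy. eapply Rle_trans; [apply Rabs_snd_le|now apply D].
Qed.

(** * The filter functions *)

Lemma is_RInt_FTC (f df : R -> R) a b l :
  (forall t, is_derive f t (df t)) -> (forall t, continuous df t) -> f b - f a = l ->
  is_RInt df a b l.
Proof. intros H1 H2 <-. apply (is_RInt_derive f df); auto. Qed.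

Lemma CInt_cis w T :
  w <> 0 -> CInt (fun t => cis (w * t)) 0 T (sin (w * T) / w, (1 - cos (w * T)) / w).
Proof.
  intros Hw. split; simpl.
  - apply (is_RInt_FTC (fun t => sin (w * t) / w)).
    + intros t. auto_derive; [trivial|]. field; assumption.
    + intros t. apply (ex_derive_continuous (fun t => cos (w * t))). auto_derive; trivial.
    + rewrite Rmult_0_r, sin_0. field; assumption.
  - apply (is_RInt_FTC (fun t => - cos (w * t) / w)).
    + intros t. auto_derive; [trivial|]. field; assumption.
    + intros t. apply (ex_derive_continuous (fun t => sin (w * t))). auto_derive; trivial.
    + rewrite Rmult_0_r, cos_0. field; assumption.
Qed.

Lemma CInt_t_cis w T :
  w <> 0 -> CInt (fun t => RtoC t * cis (w * t))%C 0 T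
    (T * sin (w * T) / w + (cos (w * T) - 1) / w ^ 2, - T * cos (w * T) / w + sin (w * T) / w ^ 2).
Proof.
  intros Hw. split; simpl.
  - eapply (is_RInt_extR (fun t => t * cos (w * t))); [intros; ring|].
    apply (is_RInt_FTC (fun t => t * sin (w * t) / w + cos (w * t) / w ^ 2)).
    + intros t. auto_derive; [trivial|]. field; assumption.
    + intros t. apply (ex_derive_continuous (fun t => t * cos (w * t))). auto_derive; trivial.
    + rewrite Rmult_0_r, sin_0, cos_0. field; assumption.
  - eapply (is_RInt_extR (fun t => t * sin (w * t))); [intros; ring|].
    apply (is_RInt_FTC (fun t => - t * cos (w * t) / w + sin (w * t) / w ^ 2)).
    + intros t. auto_derive; [trivial|]. field; assumption.
    + intros t. apply (ex_derive_continuous (fun t => t * sin (w * t))). auto_derive; trivial.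
    + rewrite Rmult_0_r, sin_0, cos_0. field; assumption.
Qed.

Lemma phi_imag th : th <> 0 -> phi (Ci * RtoC th)%C = (sin th / th, (1 - cos th) / th).
Proof.
  intros H. unfold phi, Cis0. simpl.
  destruct (Req_EM_T (0 * 0 + 1 * th) 0) as [E|_]; [lra|].
  destruct (Req_EM_T _ 0); rewrite Cexp_imag;
  unfold cis, Ci, RtoC, Cdiv, Cinv, Cmult, Cminus, Cplus, Copp; simpl; f_equal; field; lra.
Qed.

Lemma psi_imag th :
  th <> 0 -> psi (Ci * RtoC th)%C
    = (- (sin th / th + (cos th - 1) / th ^ 2), - (- cos th / th + sin th / th ^ 2)).
Proof.
  intros H. unfold psi, Cis0. simpl.
  destruct (Req_EM_T (0 * 0 + 1 * th) 0) as [E|_]; [lra|].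
  destruct (Req_EM_T _ 0); rewrite Cexp_imag;
  unfold cis, Ci, RtoC, Cdiv, Cinv, Cmult, Cminus, Cplus, Copp; simpl; f_equal; field; lra.
Qed.

Lemma Ci_0 : (Ci * RtoC 0)%C = 0%C.
Proof. unfold Ci, RtoC, Cmult; simpl. f_equal; ring. Qed.

Lemma phi_0 : phi (Ci * RtoC 0)%C = 1%C.
Proof.
  rewrite Ci_0. unfold phi, Cis0; simpl. now destruct (Req_EM_T 0 0).
Qed.

Lemma psi_0 : psi (Ci * RtoC 0)%C = RtoC (-1 / 2).
Proof.
  rewrite Ci_0. unfold psi, Cis0; simpl. now destruct (Req_EM_T 0 0).
Qed.

Lemma CInt_eq f a b l l' : CInt f a b l -> l = l' -> CInt f a b l'.
Proof. now intros H <-. Qed.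

Lemma CInt_t T : CInt (fun t => RtoC t * cis (0 * t))%C 0 T (RtoC (T ^ 2 / 2)).
Proof.
  apply CInt_ext with (fun t => RtoC t); [intros; rewrite Rmult_0_l, cis_0; ring|].
  split; simpl.
  - apply (is_RInt_FTC (fun t => t ^ 2 / 2)).
    + intros t. auto_derive; [trivial|]. field.
    + intros t. apply continuous_id.
    + field.
  - eapply is_RInt_eq; [apply is_RInt_const|].
    unfold scal; simpl; unfold Hierarchy.mult; simpl; ring.
Qed.

(** The origin of [psi]: [psi z] is minus the integral of [r e^(r z)] over [0 <= r <= 1]. With
    [r = t / tau] it integrates the diagonal phase against the interpolation weight of the right
    endpoint. *)
Lemma mpsi_int tau y :
  0 < tau ->
  CInt (fun t => RtoC (t / tau) * cis (2 * nrm2 y * t))%C 0 tau (- (RtoC tau * mpsi tau y))%C.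
Proof.
  intros Ht.
  apply CInt_ext with (fun t => RtoC (/ tau) * (RtoC t * cis (2 * nrm2 y * t)))%C.
  { intros t _. unfold Rdiv. rewrite RtoC_mult. ring. }
  unfold mpsi. destruct (Req_dec (nrm2 y) 0) as [E|E].
  - rewrite E, !Rmult_0_r, psi_0. eapply CInt_eq; [apply CInt_scal, CInt_t|].
    unfold RtoC, Cmult, Copp; simpl; f_equal; field; lra.
  - eapply CInt_eq; [apply CInt_scal, CInt_t_cis; lra|].
    rewrite psi_imag by (apply Rmult_integral_contrapositive_currified; lra).
    replace (2 * nrm2 y * tau) with (2 * tau * nrm2 y) by ring.
    unfold RtoC, Cmult, Copp; simpl; f_equal; field; lra.
Qed.

(** Since [phi z] is the integral of [e^(r z)] over [0 <= r <= 1], the sum [phi + psi] has density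
    [(1 - r) e^(r z)], the interpolation weight of the left endpoint. *)
Lemma mphi_int tau y :
  0 < tau ->
  CInt (fun t => RtoC (1 - t / tau) * cis (2 * nrm2 y * t))%C 0 tau
    (RtoC tau * (mphi tau y + mpsi tau y))%C.
Proof.
  intros Ht.
  apply CInt_ext with (fun t => cis (2 * nrm2 y * t) - RtoC (t / tau) * cis (2 * nrm2 y * t))%C.
  { intros t _. rewrite RtoC_minus. ring. }
  apply CInt_eq with (RtoC tau * mphi tau y - - (RtoC tau * mpsi tau y))%C; [|ring].
  apply CInt_minus; [|now apply mpsi_int].
  unfold mphi. destruct (Req_dec (nrm2 y) 0) as [E|E].
  - rewrite E, !Rmult_0_r, phi_0. eapply CInt_eq; [eapply CInt_ext; [|apply (CInt_const 1%C)]|].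
    + intros t _. now rewrite Rmult_0_l, cis_0.
    + now rewrite Rminus_0_r.
  - eapply CInt_eq; [apply CInt_cis; lra|].
    rewrite phi_imag by (apply Rmult_integral_contrapositive_currified; lra).
    replace (2 * nrm2 y * tau) with (2 * tau * nrm2 y) by ring.
    unfold RtoC, Cmult; simpl; f_equal; field; lra.
Qed.

Lemma Cmod_Ci_R t : Cmod (Ci * RtoC t)%C = Rabs t.
Proof.
  rewrite Cmod_mult, Cmod_R. replace (Cmod Ci) with 1; [ring|].
  unfold Cmod, Ci; simpl. rewrite <- sqrt_1 at 1. f_equal. ring.
Qed.

Lemma mphi_le tau y : Cmod (mphi tau y) <= 1.
Proof.
  unfold mphi. set (th := 2 * tau * nrm2 y). destruct (Req_dec th 0) as [->|E].
  - rewrite phi_0, Cmod_1. lra.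
  - assert (E' : phi (Ci * RtoC th)%C = ((cis th - 1) / (Ci * RtoC th))%C).
    { rewrite phi_imag by assumption.
      unfold cis, Ci, RtoC, Cdiv, Cinv, Cmult, Cminus, Cplus, Copp; simpl; f_equal; field; lra. }
    assert (Hz : (Ci * RtoC th)%C <> 0%C).
    { intros H. apply (f_equal Cmod) in H. rewrite Cmod_Ci_R, Cmod_0 in H.
      now apply Rabs_no_R0 in H. }
    rewrite E', Cmod_div by assumption. rewrite Cmod_Ci_R.
    pose proof (Rabs_pos_lt th E). apply Rle_div_l; [lra|]. rewrite Rmult_1_l. apply cis_minus_1.
Qed.

(** Writing the numerator as [(e^z - 1 - z) - z (e^z - 1)], the two parts are at most [2 |z|^2] and
    [|z|^2] on the imaginary axis, uniformly in the frequency. *)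
Lemma mpsi_le tau y : Cmod (mpsi tau y) <= 3.
Proof.
  unfold mpsi. set (th := 2 * tau * nrm2 y). destruct (Req_dec th 0) as [->|E].
  - rewrite psi_0, Cmod_R. rewrite Rabs_left; lra.
  - set (z := (Ci * RtoC th)%C).
    assert (E' : psi z = ((cis th - 1 - z - z * (cis th - 1)) / (z * z))%C).
    { unfold z. rewrite psi_imag by assumption.
      unfold cis, Ci, RtoC, Cdiv, Cinv, Cmult, Cminus, Cplus, Copp; simpl; f_equal; field; lra. }
    assert (Hm : Cmod z = Rabs th) by apply Cmod_Ci_R.
    assert (Hz : z <> 0%C).
    { intros H. rewrite H, Cmod_0 in Hm. symmetry in Hm. now apply Rabs_no_R0 in Hm. }
    rewrite E', Cmod_div by (now apply Cmult_neq_0). rewrite Cmod_mult, Hm.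
    pose proof (Rabs_pos_lt th E). apply Rle_div_l; [nra|].
    eapply Rle_trans; [apply Cmod_triangle|]. rewrite Cmod_opp, Cmod_mult, Hm.
    pose proof (cis_taylor th) as H1. fold z in H1. pose proof (cis_minus_1 th).
    rewrite <- (pow2_abs th) in H1. nra.
Qed.

(** * Duhamel's formula in the interaction picture *)

Lemma duhamel_twisted d T u0 u t s x :
  nls_solution d T u0 u -> length x = d -> 0 <= t -> 0 <= s -> t + s <= T ->
  CInt (fun r => Ci * Sch (- r) x * cubic d (u (t + r)%R) x)%C 0 s
    (Sch (- s) x * u (t + s)%R x - u t x)%C.
Proof.
  intros Hu Hx Ht Hs HT. destruct (Hu x Hx) as [_ H].
  (* Multiplication by [Sch (t - t')] frees the integrand from the endpoint [t'], so the formulas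
     for [t' = t + s] and [t' = t] can be subtracted. *)
  assert (P : forall t', 0 <= t' <= T ->
    CInt (fun r => Ci * Sch (t - r) x * cubic d (u r) x)%C 0 t'
      (Sch (t - t') x * u t' x - Sch t x * u0 x)%C).
  { intros t' Ht'. specialize (H t' Ht').
    assert (I : CInt (fun r => Ci * Sch (t' - r) x * cubic d (u r) x)%C 0 t'
      (u t' x - Sch t' x * u0 x)%C).
    { split; [apply (is_RInt_fct_extend_fst _ _ _ _ H)|apply (is_RInt_fct_extend_snd _ _ _ _ H)]. }
    apply (CInt_scal (Sch (t - t') x)) in I.
    eapply CInt_eq; [eapply CInt_ext; [|exact I]|].
    - intros r _. simpl. replace (t - r) with ((t - t') + (t' - r)) by ring.
      rewrite Sch_plus. ring.
    - replace t with ((t - t') + t') at 3 by ring. rewrite Sch_plus. ring. }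
  assert (P1 := P (t + s) ltac:(lra)). assert (P2 := P t ltac:(lra)).
  eapply CInt_eq; [eapply CInt_ext; [|apply (CInt_shift _ t s _ _ P1 P2)]|].
  - intros r _. simpl. replace (t - (t + r)) with (- r) by ring. reflexivity.
  - replace (t - (t + s)) with (- s) by ring. rewrite Rminus_diag, Sch_0. ring.
Qed.

(** * Local error *)

Lemma zsum2_comb d f1 f2 f3 (c1 c3 : C) :
  Csummable2 d f1 -> Csummable2 d f2 -> Csummable2 d f3 ->
  (c1 * zsum d (fun y => zsum d (f1 y)) - zsum d (fun y => zsum d (f2 y))
    - c3 * zsum d (fun y => zsum d (f3 y)))%C
  = zsum d (fun y => zsum d (fun z => c1 * f1 y z - f2 y z - c3 * f3 y z)%C).
Proof.
  assert (minusS : forall f g, Csummable d f -> Csummable d g -> Csummable d (fun x => f x - g x)%C).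
  { intros f g Hf Hg. eapply Csummable_ext; [|apply (Csummable_plus d f (fun x => - (1) * g x)%C Hf)].
    - intros; cbv beta; ring.
    - now apply Csummable_scal. }
  intros H1 H2 H3.
  rewrite <- !zsum_scal by now apply Csummable2_outer.
  rewrite <- !zsum_minus;
    auto using Csummable2_outer, Csummable_scal.
  apply zsum_ext. intros y Hy.
  assert (S1 := Csummable2_inner d f1 y H1 Hy).
  assert (S2 := Csummable2_inner d f2 y H2 Hy).
  assert (S3 := Csummable2_inner d f3 y H3 Hy).
  rewrite <- !zsum_scal by assumption.
  rewrite <- !zsum_minus; auto using Csummable_scal.
Qed.

Lemma inH_Sch d s t a : inH d s a -> inH d s (mult (Sch t) a).
Proof. intros [A HA]. exists A. now apply Hb_Sch. Qed.

Lemma inH_mult d s m c a :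
  (forall x, length x = d -> Cmod (m x) <= c) -> inH d s a -> inH d s (mult m a).
Proof.
  intros Hm [A HA]. exists (Rmax c 0 * A). apply Hb_mult; [apply Rmax_r| |assumption].
  intros x Hx. eapply Rle_trans; [now apply Hm|apply Rmax_l].
Qed.

Lemma Ntw_telescope d s k t a b x :
  algebra d s k -> inH d s a -> inH d s b -> length x = d ->
  (Ntw d t a a a x - Ntw d t b b b x)%C =
  (Ntw d t (Fsub a b) a a x + Ntw d t b (Fsub a b) a x + Ntw d t b b (Fsub a b) x)%C.
Proof.
  intros alg Ha Hb' Hx. unfold Ntw, mult at 1 5 9 13 17.
  assert (E : forall y, mult (Sch t) (Fsub a b) y = Fsub (mult (Sch t) a) (mult (Sch t) b) y)
    by (intros; unfold mult, Fsub; ring).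
  assert (Ec : forall y, conjF (mult (Sch t) (Fsub a b)) y
    = Fsub (conjF (mult (Sch t) a)) (conjF (mult (Sch t) b)) y).
  { intros. unfold Fsub at 2. unfold conjF. rewrite <- Cminus_conj. f_equal. apply E. }
  rewrite (conv_ext d (conjF (mult (Sch t) (Fsub a b))) _ _ _ x Hx
    (fun y _ => Ec y) (fun y _ => eq_refl)).
  rewrite (conv_ext d _ _ (conv d (mult (Sch t) (Fsub a b)) (mult (Sch t) a))
    (conv d (Fsub (mult (Sch t) a) (mult (Sch t) b)) (mult (Sch t) a)) x Hx (fun y _ => eq_refl)
    (fun y Hy => conv_ext d _ _ _ _ y Hy (fun z _ => E z) (fun z _ => eq_refl))).
  rewrite (conv_ext d _ _ (conv d (mult (Sch t) b) (mult (Sch t) (Fsub a b)))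
    (conv d (mult (Sch t) b) (Fsub (mult (Sch t) a) (mult (Sch t) b))) x Hx (fun y _ => eq_refl)
    (fun y Hy => conv_ext d _ _ _ _ y Hy (fun z _ => eq_refl) (fun z _ => E z))).
  rewrite <- !Cmult_plus_distr_l.
  rewrite <- (conv3_telescope d s k alg) by (auto using inH_conj, inH_Sch).
  ring.
Qed.

(* A first-order variation [i t |a|^2 a] of the cubic term: the two unconjugated slots
   contribute [+i t Q] each and the conjugated slot [-i t Q]. *)
Lemma quintic_split d s k t a x :
  algebra d s k -> inH d s a -> length x = d ->
  let w := fun y => (Ci * RtoC t * cubic d a y)%C in
  (conv d (conjF w) (conv d a a) x + conv d (conjF a) (conv d w a) x
    + conv d (conjF a) (conv d a w) x)%C = (Ci * RtoC t * quintic d a x)%C.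
Proof.
  intros alg Ha Hx w.
  assert (Hc : inH d s (cubic d a))
    by (apply (conv_inH d s k alg); [now apply inH_conj|now apply (conv_inH d s k alg)]).
  assert (Ha' := inH_conj d s a Ha).
  assert (CI := conv_inH d s k alg).
  assert (Haa := conv_inH d s k alg _ _ Ha Ha).
  assert (E1 : conv d (conjF w) (conv d a a) x = (- (Ci * RtoC t) * quintic d a x)%C).
  { rewrite <- (quintic_conj d s k alg) by assumption.
    rewrite <- (conv_scal_l d s k alg) by (auto using inH_conj).
    apply conv_ext; [assumption| |reflexivity].
    intros y _. unfold conjF, w. rewrite Cmult_conj.
    f_equal. unfold Cconj, Ci, RtoC, Cmult, Copp; simpl. f_equal; ring. }
  assert (E2 : conv d (conjF a) (conv d w a) x = (Ci * RtoC t * quintic d a x)%C).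
  { rewrite <- (quintic_mid d s k alg) by assumption.
    rewrite <- (conv_scal_r d s k alg) by auto.
    apply conv_ext; [assumption|reflexivity|]. intros y Hy.
    now apply (conv_scal_l d s k alg). }
  assert (E3 : conv d (conjF a) (conv d a w) x = (Ci * RtoC t * quintic d a x)%C).
  { rewrite <- (quintic_right d s k alg) by assumption.
    rewrite <- (conv_scal_r d s k alg) by auto.
    apply conv_ext; [assumption|reflexivity|]. intros y Hy.
    now apply (conv_scal_r d s k alg). }
  rewrite E1, E2, E3. ring.
Qed.

Lemma Hb_Fsub_diag d s a : Hb d s (Fsub a a) 0.
Proof.
  apply (Hb_ext d s _ (fun _ => 0%C)); [intros; unfold Fsub; ring|apply Hb_0].
Qed.

(* Constants of the local expansion for a solution of size [M] in the upper norm: the size of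
   the cubic term, the second-order remainder of the increment, the remainder of the
   nonlinearity, and the interpolation error of the oscillatory phase. *)
Definition cubic_const (k M : R) : R := k ^ 2 * (M * M * M).
Definition increment_const (k M : R) : R :=
  k ^ 2 * (4 * (M * M * M) + 3 * (cubic_const k M * M * M)).
Definition expansion_const (k M : R) : R :=
  k ^ 2 * (12 * (cubic_const k M * M * M) + 3 * (increment_const k M * M * M)
           + 3 * (cubic_const k M * cubic_const k M * M)).
Definition phase_const (k M : R) : R := 144 * k ^ 2 * (M * M * M).

Ltac nonneg := repeat first
  [apply pow2_ge_0 | apply Rplus_le_le_0_compat | apply Rmult_le_pos | assumption | lra].

Lemma cubic_const_ge0 k M : 0 <= M -> 0 <= cubic_const k M.
Proof. intros. unfold cubic_const. nonneg. Qed.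

Lemma increment_const_ge0 k M : 0 <= M -> 0 <= increment_const k M.
Proof. intros. pose proof (cubic_const_ge0 k M H). unfold increment_const. nonneg. Qed.

Lemma expansion_const_ge0 k M : 0 <= M -> 0 <= expansion_const k M.
Proof.
  intros. pose proof (cubic_const_ge0 k M H). pose proof (increment_const_ge0 k M H).
  unfold expansion_const. nonneg.
Qed.

Lemma phase_const_ge0 k M : 0 <= M -> 0 <= phase_const k M.
Proof. intros. unfold phase_const. nonneg. Qed.

Section LocalError.
Variables (d : nat) (g k M : R).
Hypothesis alg : algebra d g k.
Hypothesis alg2 : algebra d (g + 2) k.
Hypothesis M_pos : 0 <= M.

Local Notation W := (cubic_const k M).
Local Notation L2 := (increment_const k M).
Local Notation L3 := (expansion_const k M).
Local Notation L4 := (phase_const k M).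

Lemma Hb_cubic s a A : algebra d s k -> Hb d s a A -> Hb d s (cubic d a) (k ^ 2 * (A * A * A)).
Proof. intros al HA. apply (Hb_conv3 d s k al); [now apply Hb_conj|assumption|assumption]. Qed.

(* The integrand over [0 <= s <= tau] whose exact integral is the cubic part of the scheme. *)
Definition filtered (tau s : R) (a : Four) : Four := fun x =>
  (conv d (mult (fun y => RtoC (1 - s / tau) * cis (2 * nrm2 y * s))%C (conjF a)) (conv d a a) x
   + Sch (- tau) x
     * conv d (mult (fun y => Sch tau y * (RtoC (s / tau) * cis (2 * nrm2 y * s)))%C (conjF a))
         (conv d (mult (Sch tau) a) (mult (Sch tau) a)) x)%C.

(** Linear interpolation is exact on affine functions of [s], so only the Taylor remainders at [s]
    and [tau] survive, each at most [2 tau^2 b^2]. *)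
Lemma interpolation_error tau s b :
  0 < tau -> 0 <= s <= tau ->
  Cmod (cis (s * b) - RtoC (1 - s / tau) - RtoC (s / tau) * cis (tau * b))%C <= 4 * tau ^ 2 * b ^ 2.
Proof.
  intros Ht Hs.
  assert (Hr : 0 <= s / tau <= 1).
  { split; [apply Rle_div_r; lra|apply Rle_div_l; lra]. }
  replace (cis (s * b) - RtoC (1 - s / tau) - RtoC (s / tau) * cis (tau * b))%C
    with ((cis (s * b) - 1 - Ci * RtoC (s * b))
          - RtoC (s / tau) * (cis (tau * b) - 1 - Ci * RtoC (tau * b)))%C.
  - eapply Rle_trans; [apply Cmod_triangle|]. rewrite Cmod_opp, Cmod_mult, Cmod_R, Rabs_pos_eq by lra.
    pose proof (cis_taylor (s * b)) as H1. pose proof (cis_taylor (tau * b)) as H2.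
    pose proof (Cmod_ge_0 (cis (tau * b) - 1 - Ci * RtoC (tau * b))%C).
    assert (H3 : (s * b) ^ 2 <= (tau * b) ^ 2).
    { rewrite !Rpow_mult_distr. apply Rmult_le_compat_r; [apply pow2_ge_0|]. apply pow_incr; lra. }
    assert (H4 : (tau * b) ^ 2 = tau ^ 2 * b ^ 2) by ring.
    nra.
  - assert (E : RtoC (s * b) = (RtoC (s / tau) * RtoC (tau * b))%C).
    { rewrite <- RtoC_mult. f_equal. field. lra. }
    rewrite E, RtoC_minus. ring.
Qed.

Lemma mult_filter_inH tau s a :
  0 < tau -> 0 <= s <= tau -> inH d g a ->
  inH d g (mult (fun y => RtoC (1 - s / tau) * cis (2 * nrm2 y * s))%C (conjF a)) /\
  inH d g (mult (fun y => Sch tau y * (RtoC (s / tau) * cis (2 * nrm2 y * s)))%C (conjF a)).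
Proof.
  intros Ht Hs Ha.
  assert (Hr : 0 <= s / tau <= 1).
  { split; [apply Rle_div_r; lra|apply Rle_div_l; lra]. }
  split; (apply inH_mult with 1; [|now apply inH_conj]); intros y _.
  - rewrite Cmod_mult, Cmod_cis, Cmod_R, Rabs_pos_eq by lra. lra.
  - rewrite !Cmod_mult, Cmod_Sch, Cmod_cis, Cmod_R, Rabs_pos_eq by lra. lra.
Qed.

Lemma filtered_error tau s a :
  0 < tau -> 0 <= s <= tau -> Hb d (g + 2) a M ->
  Hb d g (Fsub (Ntw d s a a a) (filtered tau s a)) (L4 * tau ^ 2).
Proof.
  intros Ht Hs Ha.
  assert (Ia : inH d g a) by (exists M; now apply Hb_mono).
  assert (Iab := inH_conj d g a Ia).
  set (b := fun x => (RtoC (1 + nrm2 x) * a x)%C).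
  (* The constant is [4 * 36], from the interpolation error and the resonance bound. Each of the
     three factors receives one weight [1 + nrm2]. *)
  set (b' := fun x => (RtoC (144 * tau ^ 2 * (1 + nrm2 x)) * conjF a x)%C).
  assert (Hp : 0 <= 144 * tau ^ 2) by (pose proof (pow2_ge_0 tau); lra).
  assert (Bb : Hb d g b M).
  { eapply Hb_le; [|apply (Hb_gain d g 1 a b M); [lra| |assumption]]; [lra|].
    intros x _. unfold b. pose proof (nrm2_ge0 x).
    rewrite Cmod_mult, Cmod_R, Rabs_pos_eq by lra. lra. }
  assert (Bb' : Hb d g b' (144 * tau ^ 2 * M)).
  { apply (Hb_gain d g (144 * tau ^ 2) (conjF a)); [assumption| |now apply Hb_conj].
    intros x _. unfold b'. pose proof (nrm2_ge0 x).
    rewrite Cmod_mult, Cmod_R, Rabs_pos_eq; [lra|]. apply Rmult_le_pos; lra. }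
  assert (Ib : inH d g b) by (exists M; assumption).
  assert (Ib' : inH d g b') by (eexists; eassumption).
  apply (Hb_dom d g _ (conv d (absF b') (conv d (absF b) (absF b)))).
  2:{ eapply Hb_le; [|apply (Hb_conv3 d g k alg); apply Hb_absF; eassumption].
      unfold phase_const. right; ring. }
  intros x Hx.
  destruct (mult_filter_inH tau s a Ht Hs Ia) as [I1 I2].
  unfold Fsub, Ntw, filtered. unfold mult at 1.
  rewrite !(conv3_eq d g k alg) by (auto using inH_Sch).
  match goal with |- Cmod (?p - (?q + ?r))%C <= _ =>
    replace (p - (q + r))%C with (p - q - r)%C by ring end.
  rewrite zsum2_comb by (apply (conv3_summable d g k alg); auto using inH_Sch, inH_conj).
  apply (conv3_dom d g k alg); try assumption.
  intros y z Hy Hz.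
  set (q := vsub (vsub x y) z).
  set (be := nrm2 x - nrm2 y - nrm2 z - nrm2 q).
  (* All three symbols share the phase [e^(2is|y|^2)]; what remains is the interpolation error of
     [e^(is be)]. *)
  match goal with |- Cmod ?p <= _ =>
    replace p with (cis (2 * nrm2 y * s)
      * (cis (s * be) - RtoC (1 - s / tau) - RtoC (s / tau) * cis (tau * be))
      * (conjF a y * (a z * a q)))%C end.
  - rewrite !Cmod_mult, Cmod_cis, Rmult_1_l.
    pose proof (nrm2_ge0 y). pose proof (nrm2_ge0 z). pose proof (nrm2_ge0 q).
    unfold b', b. rewrite !Cmod_mult, !Cmod_R.
    rewrite !Rabs_pos_eq by (try apply Rmult_le_pos; lra).
    pose proof (interpolation_error tau s be Ht Hs) as H3.
    pose proof (resonance_bound d x y z Hx Hy Hz) as H4. fold q in H4. fold be in H4.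
    apply Rle_trans with (144 * tau ^ 2 * ((1 + nrm2 y) * ((1 + nrm2 z) * (1 + nrm2 q)))
      * (Cmod (conjF a y) * (Cmod (a z) * Cmod (a q)))).
    + apply Rmult_le_compat_r.
      * repeat apply Rmult_le_pos; apply Cmod_ge_0.
      * eapply Rle_trans; [exact H3|].
        replace (144 * tau ^ 2 * ((1 + nrm2 y) * ((1 + nrm2 z) * (1 + nrm2 q))))
          with (4 * tau ^ 2 * (36 * ((1 + nrm2 y) * ((1 + nrm2 z) * (1 + nrm2 q))))) by ring.
        apply Rmult_le_compat_l; [lra|exact H4].
    + right; ring.
  - rewrite conjF_Sch. unfold mult. fold q.
    assert (E1 : (Sch (- s) x * (Sch (- s) y * (Sch s z * Sch s q)))%C
      = (cis (2 * nrm2 y * s) * cis (s * be))%C).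
    { rewrite !Sch_cis, <- !cis_plus. f_equal. unfold be. ring. }
    (* The multiplier on the conjugated factor is [Sch tau], not the [Sch (- tau)] that conjugation
       would give; the difference removes [2 |y|^2] from the endpoint phase and leaves [be]. *)
    assert (E2 : (Sch (- tau) x * (Sch tau y * (Sch tau z * Sch tau q)))%C = cis (tau * be)).
    { rewrite !Sch_cis, <- !cis_plus. f_equal. unfold be. ring. }
    transitivity ((cis (2 * nrm2 y * s) * cis (s * be)) * (conjF a y * (a z * a q))
      - RtoC (1 - s / tau) * cis (2 * nrm2 y * s) * (conjF a y * (a z * a q))
      - cis (tau * be) * RtoC (s / tau) * cis (2 * nrm2 y * s) * (conjF a y * (a z * a q)))%C;
      [ring|]. rewrite <- E1, <- E2. ring.
Qed.

Section Solution.
Variables (T t : R) (u0 : Four) (u : R -> Four).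
Hypothesis sol : nls_solution d T u0 u.
Hypothesis u_bound : forall r, 0 <= r <= T -> Hb d (g + 2) (u r) M.
Hypothesis t_pos : 0 <= t.

Let v (s : R) : Four := mult (Sch (- s)) (u (t + s)).
Let v0 : Four := u t.
Let w : Four := cubic d v0.

Lemma v_bound s : 0 <= s -> t + s <= T -> Hb d (g + 2) (v s) M.
Proof. intros Hs HT. apply Hb_Sch, u_bound. lra. Qed.

(** The argument [s] witnesses [t <= T]. *)
Lemma v0_bound s : 0 <= s -> t + s <= T -> Hb d (g + 2) v0 M.
Proof. intros. apply u_bound. lra. Qed.

Lemma Ntw_v s x :
  length x = d -> Ntw d s (v s) (v s) (v s) x = (Sch (- s) x * cubic d (u (t + s)%R) x)%C.
Proof.
  intros Hx. unfold Ntw, mult at 1, cubic. f_equal.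
  assert (E : forall y, mult (Sch s) (v s) y = u (t + s) y).
  { intros y. unfold mult, v, mult. rewrite Cmult_assoc, Sch_inv. ring. }
  apply conv_ext; [assumption| |].
  - intros y _. unfold conjF. f_equal. apply E.
  - intros y Hy. apply conv_ext; auto.
Qed.

Lemma duhamel_v s x :
  length x = d -> 0 <= s -> t + s <= T ->
  CInt (fun r => Ci * Ntw d r (v r) (v r) (v r) x)%C 0 s (Fsub (v s) v0 x).
Proof.
  intros Hx Hs HT. eapply CInt_ext; [|apply (duhamel_twisted d T u0 u t s x); assumption].
  intros r _. cbv beta. rewrite Ntw_v by assumption. ring.
Qed.

Lemma Cmod_Ci : Cmod Ci = 1.
Proof. rewrite <- (Rabs_R1), <- (Cmod_Ci_R 1). f_equal. ring. Qed.

(** The free flow preserves the upper norm and that space is an algebra, so the Duhamel integrand is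
    bounded there without loss of derivatives. *)
Lemma increment_bound s :
  0 <= s -> t + s <= T -> Hb d (g + 2) (Fsub (v s) v0) (s * W).
Proof.
  intros Hs HT.
  apply (Hb_int d (g + 2) (fun r x => Ci * (Sch (- r) x * cubic d (u (t + r)%R) x))%C);
    [assumption|apply (cubic_const_ge0 k M M_pos)| |].
  - intros x Hx. eapply CInt_ext; [|apply (duhamel_v s x); assumption].
    intros r _. cbv beta. now rewrite Ntw_v.
  - intros r Hr. eapply Hb_le; [|apply Hb_scal,
      (Hb_Sch d (g + 2) (- r) (cubic d (u (t + r)))), (Hb_cubic (g + 2) _ M)].
    + rewrite Cmod_Ci. unfold cubic_const. right; ring.
    + assumption.
    + apply u_bound. lra.
Qed.

Lemma w_bound s : 0 <= s -> t + s <= T -> Hb d (g + 2) w W.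
Proof. intros. apply Hb_cubic; [assumption|]. apply (v0_bound s); assumption. Qed.

(** Freezing the flows and the solution at time 0 inside the Duhamel integral costs [O(r)] and two
    derivatives; integration supplies the second power of [s]. *)
Lemma increment_first_order s :
  0 <= s -> t + s <= T ->
  Hb d g (Fsub (Fsub (v s) v0) (fun x => Ci * RtoC s * w x)%C) (s * (L2 * s)).
Proof.
  intros Hs HT. pose proof (increment_const_ge0 k M M_pos). pose proof (cubic_const_ge0 k M M_pos).
  apply (Hb_int d g (fun r x => Ci * Fsub (Ntw d r (v r) (v r) (v r)) w x)%C);
    [assumption|now apply Rmult_le_pos| |].
  - intros x Hx. eapply CInt_eq; [eapply CInt_ext; [|apply CInt_minus;
      [apply (duhamel_v s x); assumption|apply (CInt_const (Ci * w x)%C)]]|].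
    + intros r _. cbv beta. unfold Fsub. ring.
    + unfold Fsub. rewrite Rminus_0_r. ring.
  - intros r Hr.
    eapply Hb_le; [|apply Hb_scal, (Ntw_cmp d g k) with (C' := M);
      [assumption|assumption|apply Hr|apply v_bound; lra|apply v_bound; lra|apply v_bound; lra
      |apply Hb_mono, (v0_bound s); lra|apply Hb_mono, (v0_bound s); lra|apply Hb_mono, (v0_bound s); lra
      |apply Hb_mono, increment_bound; lra|apply Hb_mono, increment_bound; lra
      |apply Hb_mono, increment_bound; lra]].
    rewrite Cmod_Ci.
    replace (1 * (k ^ 2 * (4 * r * (M * M * M) + r * W * M * M + M * (r * W) * M + M * M * (r * W))))
      with (L2 * r) by (unfold increment_const; ring).
    apply Rmult_le_compat_l; lra.
Qed.

(** After telescoping, each term contains one increment [de], which is already [O(s)]. Freezing the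
    flows or replacing another increment-dependent argument by [v0] gains a further factor [s], and
    replacing [de] by its first-order part leaves an [O(s^2)] error directly. *)
Lemma nonlinear_expansion s :
  0 <= s -> t + s <= T ->
  Hb d g (fun x => Ntw d s (v s) (v s) (v s) x - Ntw d s v0 v0 v0 x
                   - Ci * RtoC s * quintic d v0 x)%C (L3 * s ^ 2).
Proof.
  intros Hs HT.
  assert (B := v_bound s Hs HT). assert (B0 := v0_bound s Hs HT).
  assert (BD := increment_bound s Hs HT). assert (Bw := w_bound s Hs HT).
  assert (BF := increment_first_order s Hs HT).
  set (de := Fsub (v s) v0) in *.
  set (w' := fun x => (Ci * RtoC s * w x)%C) in *.
  assert (Bw' : Hb d g w' (s * W)).
  { eapply Hb_le; [|apply Hb_scal, Hb_mono, Bw]. rewrite Cmod_Ci_R, Rabs_pos_eq by assumption. lra. }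
  assert (C1 := Ntw_cmp d g k s de (v s) (v s) w' v0 v0 _ _ _ _ _ _ _ _ _ alg alg2 Hs
    BD B B Bw' (Hb_mono _ _ _ _ B0) (Hb_mono _ _ _ _ B0) BF (Hb_mono _ _ _ _ BD) (Hb_mono _ _ _ _ BD)).
  assert (C2 := Ntw_cmp d g k s v0 de (v s) v0 w' v0 _ _ _ _ _ _ _ _ _ alg alg2 Hs
    B0 BD B (Hb_mono _ _ _ _ B0) Bw' (Hb_mono _ _ _ _ B0) (Hb_Fsub_diag d g v0) BF (Hb_mono _ _ _ _ BD)).
  assert (C3 := Ntw_cmp d g k s v0 v0 de v0 v0 w' _ _ _ _ _ _ _ _ _ alg alg2 Hs
    B0 B0 BD (Hb_mono _ _ _ _ B0) (Hb_mono _ _ _ _ B0) Bw'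
    (Hb_Fsub_diag d g v0) (Hb_Fsub_diag d g v0) BF).
  apply (Hb_ext d g _ (fun x => (Fsub (Ntw d s de (v s) (v s)) (conv d (conjF w') (conv d v0 v0)) x
     + Fsub (Ntw d s v0 de (v s)) (conv d (conjF v0) (conv d w' v0)) x)
     + Fsub (Ntw d s v0 v0 de) (conv d (conjF v0) (conv d v0 w')) x)%C).
  - intros x Hx. rewrite (Ntw_telescope d g k s (v s) v0 x alg) by
      ((eexists; apply Hb_mono; eassumption) || assumption).
    rewrite <- (quintic_split d g k s v0 x alg) by ((eexists; apply Hb_mono; eassumption) || assumption).
    fold de. unfold Fsub. change (fun y => (Ci * RtoC s * cubic d v0 y)%C) with w'. ring.
  - eapply Hb_le; [|apply Hb_plus; [apply Hb_plus|]; eassumption].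
    right. unfold expansion_const. ring.
Qed.

Lemma filtered_int tau x :
  0 < tau -> t + tau <= T -> length x = d ->
  CInt (fun s => filtered tau s v0 x) 0 tau
    (RtoC tau * conv d (mult (fun y => mphi tau y + mpsi tau y)%C (conjF v0)) (conv d v0 v0) x
     - RtoC tau * (Sch (- tau) x
       * conv d (mult (fun y => Sch tau y * mpsi tau y)%C (conjF v0))
           (conv d (mult (Sch tau) v0) (mult (Sch tau) v0)) x))%C.
Proof.
  intros Ht HT Hx.
  assert (I0 : inH d g v0) by (exists M; apply Hb_mono, (v0_bound tau); lra).
  assert (Ic := inH_conj d g v0 I0). assert (IS := inH_Sch d g tau v0 I0).
  assert (I00 := conv_inH d g k alg _ _ I0 I0). assert (ISS := conv_inH d g k alg _ _ IS IS).
  assert (Hr : forall s, 0 <= s <= tau -> 0 <= s / tau <= 1).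
  { intros s Hs. split; [apply Rle_div_r; lra|apply Rle_div_l; lra]. }
  assert (J1 := CInt_conv d (fun s y => RtoC (1 - s / tau) * cis (2 * nrm2 y * s))%C
    (fun y => RtoC tau * (mphi tau y + mpsi tau y))%C (conjF v0) (conv d v0 v0) x tau
    ltac:(lra) Hx (fun y _ => mphi_int tau y Ht)
    ltac:(intros s y Hs; specialize (Hr s Hs); cbv beta;
      rewrite Cmod_mult, Cmod_cis, Cmod_R, Rabs_pos_eq; lra)
    (conv_sm d g k alg _ _ x Ic I00 Hx)).
  assert (J2 := CInt_conv d (fun s y => Sch tau y * (RtoC (s / tau) * cis (2 * nrm2 y * s)))%C
    (fun y => Sch tau y * - (RtoC tau * mpsi tau y))%C (conjF v0)
    (conv d (mult (Sch tau) v0) (mult (Sch tau) v0)) x tau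
    ltac:(lra) Hx (fun y _ => CInt_scal (Sch tau y) _ _ _ _ (mpsi_int tau y Ht))
    ltac:(intros s y Hs; specialize (Hr s Hs); cbv beta;
      rewrite !Cmod_mult, Cmod_Sch, Cmod_cis, Cmod_R, Rabs_pos_eq; lra)
    (conv_sm d g k alg _ _ x Ic ISS Hx)).
  eapply CInt_eq; [apply CInt_plus; [exact J1|apply CInt_scal; exact J2]|].
  rewrite (conv_ext d (mult (fun y => RtoC tau * (mphi tau y + mpsi tau y))%C (conjF v0))
    (fun y => RtoC tau * mult (fun y => mphi tau y + mpsi tau y)%C (conjF v0) y)%C
    (conv d v0 v0) (conv d v0 v0) x Hx) by (auto; intros; unfold mult; ring).
  rewrite (conv_ext d (mult (fun y => Sch tau y * - (RtoC tau * mpsi tau y))%C (conjF v0))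
    (fun y => - RtoC tau * mult (fun y => Sch tau y * mpsi tau y)%C (conjF v0) y)%C
    (conv d (mult (Sch tau) v0) (mult (Sch tau) v0)) _ x Hx (fun y _ => ltac:(unfold mult; ring))
    (fun y _ => eq_refl)).
  rewrite !(conv_scal_l d g k alg); try assumption; [ring| |].
  - apply inH_mult with 3; [|assumption]. intros y _.
    rewrite Cmod_mult, Cmod_Sch, Rmult_1_l. apply mpsi_le.
  - apply inH_mult with 4; [|assumption]. intros y _.
    eapply Rle_trans; [apply Cmod_triangle|].
    pose proof (mphi_le tau y). pose proof (mpsi_le tau y). lra.
Qed.

Lemma local_error tau :
  0 < tau -> t + tau <= T ->
  Hb d g (Fsub (u (t + tau)) (step d tau (u t))) ((L3 + L4) * tau ^ 3).
Proof.
  intros Ht HT. pose proof (expansion_const_ge0 k M M_pos). pose proof (phase_const_ge0 k M M_pos).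
  (* [F] is the one-step error pulled back by the free flow. Its last term is the integral of
     [i (i s)] times the quintic, which yields the coefficient [- tau^2 / 2] of the scheme. *)
  set (F := fun x => (Fsub (v tau) v0 x
    - Ci * (RtoC tau * conv d (mult (fun y => mphi tau y + mpsi tau y)%C (conjF v0)) (conv d v0 v0) x
     - RtoC tau * (Sch (- tau) x
       * conv d (mult (fun y => Sch tau y * mpsi tau y)%C (conjF v0))
           (conv d (mult (Sch tau) v0) (mult (Sch tau) v0)) x))
    - (Ci * Ci * quintic d v0 x) * RtoC (tau ^ 2 / 2))%C).
  apply (Hb_ext d g _ (mult (Sch tau) F)).
  { intros x Hx. unfold mult at 1, F, Fsub, v, mult at 1, step. fold v0.
    assert (E := Sch_inv tau x).
    assert (Eu : u (t + tau)%R x = (Sch tau x * (Sch (- tau) x * u (t + tau)%R x))%C)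
      by (rewrite Cmult_assoc, E; ring).
    rewrite Eu at 1.
    assert (Ei : (Ci * Ci)%C = (- (1))%C) by (unfold Ci, Cmult, Copp, RtoC; simpl; f_equal; ring).
    rewrite Ei.
    set (X := conv d (mult (fun k0 => Sch tau k0 * mpsi tau k0)%C (conjF v0)) _ x).
    transitivity (Sch tau x * (Sch (- tau) x * u (t + tau)%R x) - (Sch tau x * v0 x +
      Ci * RtoC tau * Sch tau x
        * conv d (mult (fun k0 => mphi tau k0 + mpsi tau k0)%C (conjF v0)) (conv d v0 v0) x
      - Ci * RtoC tau * ((Sch tau x * Sch (- tau) x) * X)
      - RtoC (tau ^ 2 / 2) * Sch tau x * quintic d v0 x))%C.
    - rewrite E. ring.
    - ring. }
  apply Hb_Sch.
  replace ((L3 + L4) * tau ^ 3) with (tau * ((L3 + L4) * tau ^ 2)) by ring.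
  apply (Hb_int d g (fun s x => Ci * ((Ntw d s (v s) (v s) (v s) x - Ntw d s v0 v0 v0 x
                   - Ci * RtoC s * quintic d v0 x) + Fsub (Ntw d s v0 v0 v0) (filtered tau s v0) x))%C);
    [lra|apply Rmult_le_pos; [lra|apply pow2_ge_0]| |].
  - intros x Hx.
    assert (J1 := duhamel_v tau x Hx ltac:(lra) HT).
    assert (J2 := CInt_scal Ci _ _ _ _ (filtered_int tau x Ht HT Hx)).
    assert (J3 := CInt_scal (Ci * Ci * quintic d v0 x)%C _ _ _ _ (CInt_t tau)).
    eapply CInt_ext; [|exact (CInt_minus _ _ _ _ _ _ (CInt_minus _ _ _ _ _ _ J1 J2) J3)].
    intros s _. cbv beta. rewrite Rmult_0_l, cis_0. unfold Fsub. ring.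
  - intros s Hs.
    eapply Hb_le; [|apply Hb_scal, Hb_plus; [apply nonlinear_expansion|apply filtered_error]]; try lra.
    + rewrite Cmod_Ci. assert (s ^ 2 <= tau ^ 2) by (apply pow_incr; lra). nra.
    + apply (v0_bound tau); lra.
Qed.

End Solution.
End LocalError.

Lemma local_error_bound d g k M :
  algebra d g k -> algebra d (g + 2) k -> 0 <= M ->
  exists L, 0 <= L /\ forall T t u0 u tau,
    nls_solution d T u0 u -> (forall r, 0 <= r <= T -> Hb d (g + 2) (u r) M) ->
    0 <= t -> 0 < tau -> t + tau <= T ->
    Hb d g (Fsub (u (t + tau)) (step d tau (u t))) (L * tau ^ 3).
Proof.
  intros alg alg2 HM. eexists. split; cycle 1.
  - intros T t u0 u tau H1 H2 H3 H4 H5.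
    exact (local_error d g k M alg alg2 HM T t u0 u H1 H2 H3 tau H4 H5).
  - apply Rplus_le_le_0_compat; [now apply expansion_const_ge0|now apply phase_const_ge0].
Qed.

(** * Stability *)

Lemma Hb_mult_sub d s m c a b D :
  0 <= c -> (forall x, length x = d -> Cmod (m x) <= c) -> Hb d s (Fsub a b) D ->
  Hb d s (Fsub (mult m a) (mult m b)) (c * D).
Proof.
  intros Hc Hm HD. apply (Hb_ext d s _ (mult m (Fsub a b))); [|now apply Hb_mult].
  intros; unfold Fsub, mult; ring.
Qed.

(** One estimate for both cubic terms of the scheme: [m] is the filter on the conjugated factor, and
    [m'] is 1 in the first term and the free flow in the second. *)
Lemma filtered_lip d s k m m' c a b A D :
  algebra d s k -> 0 <= c -> (forall x, length x = d -> Cmod (m x) <= c) ->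
  (forall x, length x = d -> Cmod (m' x) <= 1) ->
  Hb d s a A -> Hb d s b A -> Hb d s (Fsub a b) D ->
  Hb d s (Fsub (conv d (mult m (conjF a)) (conv d (mult m' a) (mult m' a)))
               (conv d (mult m (conjF b)) (conv d (mult m' b) (mult m' b))))
    (3 * c * k ^ 2 * A ^ 2 * D).
Proof.
  intros alg Hc Hm Hm' Ha Hb' HD.
  assert (Ha1 := Hb_mult d s m' 1 a A ltac:(lra) Hm' Ha).
  assert (Hb1 := Hb_mult d s m' 1 b A ltac:(lra) Hm' Hb').
  assert (HD1 := Hb_mult_sub d s m' 1 a b D ltac:(lra) Hm' HD).
  eapply Hb_le; [|eapply (conv3_lip d s k alg);
    [apply Hb_mult; [exact Hc|exact Hm|apply Hb_conj, Ha]|exact Ha1|exact Ha1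
    |apply Hb_mult; [exact Hc|exact Hm|apply Hb_conj, Hb']|exact Hb1|exact Hb1
    |apply Hb_mult_sub; [exact Hc|exact Hm|apply Hb_conj_sub, HD]|exact HD1|exact HD1]].
  right; ring.
Qed.

Lemma cubic_lip d s k a b A D :
  algebra d s k -> Hb d s a A -> Hb d s b A -> Hb d s (Fsub a b) D ->
  Hb d s (Fsub (cubic d a) (cubic d b)) (3 * k ^ 2 * A ^ 2 * D).
Proof.
  intros alg Ha Hb' HD.
  eapply Hb_le; [|eapply (conv3_lip d s k alg);
    [apply Hb_conj, Ha|exact Ha|exact Ha|apply Hb_conj, Hb'|exact Hb'|exact Hb'
    |apply Hb_conj_sub, HD|exact HD|exact HD]].
  right; ring.
Qed.

Lemma quintic_lip d s k a b A D :
  algebra d s k -> Hb d s a A -> Hb d s b A -> Hb d s (Fsub a b) D ->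
  Hb d s (Fsub (quintic d a) (quintic d b)) (5 * k ^ 4 * A ^ 4 * D).
Proof.
  intros alg Ha Hb' HD.
  apply (Hb_ext d s _ (Fsub (conv d (conjF a) (conv d a (cubic d a)))
                            (conv d (conjF b) (conv d b (cubic d b))))).
  - intros x Hx. unfold Fsub.
    now rewrite !(quintic_right d s k alg) by ((eexists; eassumption) || assumption).
  - assert (Hc : forall f, Hb d s f A -> Hb d s (cubic d f) (k ^ 2 * (A * A * A)))
      by (intros f Hf; apply (Hb_conv3 d s k alg); [now apply Hb_conj|assumption|assumption]).
    eapply Hb_le; [|eapply (conv3_lip d s k alg);
      [apply Hb_conj, Ha|exact Ha|apply Hc, Ha|apply Hb_conj, Hb'|exact Hb'|apply Hc, Hb'
      |apply Hb_conj_sub, HD|exact HD|apply (cubic_lip d s k a b A D alg Ha Hb' HD)]].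
    right; ring.
Qed.

(** The leading 1 is exact because the free flow is an isometry. The 21 is [3 * 4 + 3 * 3], from the
    filter bounds 4 and 3 on three slots each; [tau <= 1] lets the quintic weight [tau^2 / 2] be
    absorbed into [tau]. *)
Lemma step_lip d s k tau a b A D :
  algebra d s k -> 0 < tau <= 1 -> Hb d s a A -> Hb d s b A -> Hb d s (Fsub a b) D ->
  Hb d s (Fsub (step d tau a) (step d tau b))
    ((1 + tau * (21 * k ^ 2 * A ^ 2 + 5 * k ^ 4 * A ^ 4)) * D).
Proof.
  intros alg Ht Ha Hb' HD.
  assert (HDp : 0 <= D) by apply HD. assert (HAp : 0 <= A) by apply Ha.
  assert (Ia : inH d s a) by (eexists; eassumption).
  assert (Ib : inH d s b) by (eexists; eassumption).
  assert (T1 := filtered_lip d s k (fun y => mphi tau y + mpsi tau y)%C (fun _ => 1%C) 4 a b A D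
    alg ltac:(lra)
    ltac:(intros y _; eapply Rle_trans; [apply Cmod_triangle|];
          pose proof (mphi_le tau y); pose proof (mpsi_le tau y); lra)
    ltac:(intros; cbv beta; rewrite Cmod_1; lra) Ha Hb' HD).
  assert (T2 := filtered_lip d s k (fun y => Sch tau y * mpsi tau y)%C (Sch tau) 3 a b A D
    alg ltac:(lra)
    ltac:(intros y _; cbv beta; rewrite Cmod_mult, Cmod_Sch, Rmult_1_l; apply mpsi_le)
    ltac:(intros; cbv beta; rewrite Cmod_Sch; lra) Ha Hb' HD).
  assert (T3 := quintic_lip d s k a b A D alg Ha Hb' HD).
  apply (Hb_scal d s (Ci * RtoC tau)%C) in T2.
  apply (Hb_Sch d s tau), (Hb_scal d s (Ci * RtoC tau)%C) in T1.
  apply (Hb_Sch d s tau), (Hb_scal d s (RtoC (tau ^ 2 / 2))) in T3.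
  assert (T0 := Hb_Sch d s tau _ _ HD).
  assert (T := Hb_sub _ _ _ _ _ _ (Hb_sub _ _ _ _ _ _ (Hb_plus _ _ _ _ _ _ T0 T1) T2) T3).
  eapply Hb_le; [|eapply Hb_ext; [|exact T]].
  - rewrite Cmod_Ci_R, Cmod_R, !Rabs_pos_eq
      by (try (apply Rle_div_r; [lra|]; rewrite Rmult_0_l; apply pow2_ge_0); lra).
    assert (0 <= 5 * k ^ 4 * A ^ 4 * D).
    { apply Rmult_le_pos; [|assumption]. apply Rmult_le_pos; [|apply pow_le; assumption].
      apply Rmult_le_pos; [lra|]. apply pow_le, (proj1 alg). }
    assert (tau ^ 2 / 2 <= tau) by nra.
    assert (tau ^ 2 / 2 * (5 * k ^ 4 * A ^ 4 * D) <= tau * (5 * k ^ 4 * A ^ 4 * D))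
      by now apply Rmult_le_compat_r.
    lra.
  - intros x Hx. unfold step, Fsub.
    assert (E : forall f, conv d (mult (fun y => mphi tau y + mpsi tau y)%C (conjF f))
         (conv d (mult (fun _ => 1%C) f) (mult (fun _ => 1%C) f)) x
       = conv d (mult (fun y => mphi tau y + mpsi tau y)%C (conjF f)) (conv d f f) x).
    { intros f. apply conv_ext; auto. intros y Hy. apply conv_ext; auto;
      intros; unfold mult; apply Cmult_1_l. }
    rewrite <- (E a), <- (E b). unfold mult. ring.
Qed.

(** * Convergence *)

(** The box sums increase, so each lies below the limit. [Rabs M] keeps the bound nonnegative for
    any real [M], and nonnegativity of the sums rules out the value [m_infty]. *)
Lemma Hnorm_le_Hb d s a M :
  Rbar_le (Hnorm d s a) (Finite M) -> Hb d s a (Rabs M / sqrt ((2 * PI) ^ d)).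
Proof.
  set (P := (2 * PI) ^ d). assert (HP : 0 < P) by (apply pow_lt; pose proof PI_RGT_0; lra).
  pose proof (sqrt_lt_R0 P HP) as HsP.
  set (S := fun N => Rlsum (box d N) (fun x => P * Rpower (1 + nrm2 x) s * Cmod (a x) ^ 2)).
  assert (HS : forall N, S N = P * Rlsum (box d N) (fun x => wt s x * Cmod (a x) ^ 2)).
  { intros N. unfold S. rewrite <- Rlsum_scal. apply Rlsum_ext. intros. unfold wt. ring. }
  assert (Hinc : forall N, S N <= S (N + 1)%nat).
  { intros N. apply Rlsum_box_mono; [|lia]. intros x _.
    apply Rmult_le_pos; [|apply pow2_ge_0]. left. apply Rmult_lt_0_compat; [assumption|apply exp_pos]. }
  assert (L := Lim_seq_correct S ltac:(apply ex_lim_seq_incr; intros n;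
    replace (Datatypes.S n) with (n + 1)%nat by lia; apply Hinc)).
  unfold Hnorm. fold P. change (Lim_seq (fun N => Rlsum (box d N) _)) with (Lim_seq S).
  destruct (Lim_seq S) as [r| |] eqn:E; simpl.
  - intros H. split; [apply Rdiv_le_0_compat; [apply Rabs_pos|assumption]|].
    intros N.
    assert (HN : S N <= r).
    { apply (is_lim_seq_incr_compare _ _ L). intros n.
      replace (Datatypes.S n) with (n + 1)%nat by lia. apply Hinc. }
    assert (Hr : 0 <= r).
    { eapply Rle_trans; [|exact HN]. rewrite HS. apply Rmult_le_pos; [lra|apply wt_sum_ge0]. }
    assert (r <= Rabs M ^ 2).
    { rewrite <- (sqrt_sqrt r Hr). pose proof (sqrt_pos r). pose proof (Rle_abs M). nra. }
    replace ((Rabs M / sqrt P) ^ 2) with (Rabs M ^ 2 / P).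
    + apply Rle_div_r; [assumption|]. rewrite Rmult_comm, <- HS. lra.
    + unfold Rdiv. rewrite Rpow_mult_distr, pow_inv, pow2_sqrt by lra. reflexivity.
  - intros [].
  - intros _. exfalso.
    assert (Rbar_le 0 m_infty).
    { refine (is_lim_seq_le _ _ _ _ _ (is_lim_seq_const 0) L).
      intros n. rewrite HS. apply Rmult_le_pos; [lra|apply wt_sum_ge0]. }
    contradiction.
Qed.

Lemma Hb_Hnorm_le d s a A :
  Hb d s a A -> Rbar_le (Hnorm d s a) (Finite (sqrt ((2 * PI) ^ d) * A)).
Proof.
  intros [HA HB].
  set (P := (2 * PI) ^ d). assert (HP : 0 < P) by (apply pow_lt; pose proof PI_RGT_0; lra).
  set (S := fun N => Rlsum (box d N) (fun x => P * Rpower (1 + nrm2 x) s * Cmod (a x) ^ 2)).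
  assert (HS : forall N, S N <= P * A ^ 2).
  { intros N. eapply Rle_trans; [|apply Rmult_le_compat_l; [lra|apply (HB N)]].
    right. unfold S. rewrite <- Rlsum_scal. apply Rlsum_ext. intros. unfold wt. ring. }
  assert (L : Rbar_le (Lim_seq S) (P * A ^ 2)).
  { rewrite <- (Lim_seq_const (P * A ^ 2)). apply Lim_seq_le_loc. exists 0%nat. intros n _. apply HS. }
  unfold Hnorm. fold P. change (Lim_seq (fun N => Rlsum (box d N) _)) with (Lim_seq S).
  destruct (Lim_seq S) as [r| |]; simpl in *.
  - eapply Rle_trans; [apply sqrt_le_1_alt, L|].
    rewrite sqrt_mult_alt by lra. right. f_equal.
    replace (A * (A * 1)) with (A ^ 2) by ring. now apply sqrt_pow2.
  - contradiction.
  - trivial.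
Qed.

Lemma exp_le_exp x y : x <= y -> exp x <= exp y.
Proof. intros [H| ->]; [left; now apply exp_increasing|lra]. Qed.

Lemma one_plus_le_exp x : 1 + x <= exp x.
Proof.
  destruct (Req_dec x 0) as [->|H]; [rewrite exp_0; lra|]. left. now apply exp_ineq1.
Qed.

(* Discrete Gronwall together with the bootstrap of the a priori bound [M + 1] on the
   numerical solution. *)
Lemma global_error d g k M T :
  algebra d g k -> algebra d (g + 2) k -> 0 <= M -> 0 < T ->
  exists tau0 C1, 0 < tau0 /\ 0 <= C1 /\ forall u0 u,
    nls_solution d T u0 u -> (forall r, 0 <= r <= T -> Hb d (g + 2) (u r) M) ->
    forall tau, 0 < tau <= tau0 -> forall n : nat, INR n * tau <= T ->
    Hb d g (Fsub (u (INR n * tau)) (numsol d tau u0 n)) (C1 * tau ^ 2).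
Proof.
  intros alg alg2 HM HT.
  destruct (local_error_bound d g k M alg alg2 HM) as [L [HL Hloc]].
  set (A := M + 1). set (S := 21 * k ^ 2 * A ^ 2 + 5 * k ^ 4 * A ^ 4).
  assert (HS : 0 <= S).
  { unfold S, A. assert (0 <= k) by apply alg.
    apply Rplus_le_le_0_compat; (apply Rmult_le_pos; [apply Rmult_le_pos; [lra|]|]);
      apply pow_le; lra. }
  set (C1 := L * T * exp (S * T)).
  assert (HC : 0 <= C1).
  { unfold C1. apply Rmult_le_pos; [apply Rmult_le_pos; lra|left; apply exp_pos]. }
  (* The bound 1 is for the Lipschitz estimate of a step; the other gives [C1 * tau ^ 2 <= 1], which
     keeps the numerical solution within distance 1 of the exact one. *)
  exists (Rmin 1 (/ (C1 + 1))), C1.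
  split; [apply Rmin_glb_lt; [lra|apply Rinv_0_lt_compat; lra]|split; [assumption|]].
  intros u0 u Hsol Hu tau [Ht0 Ht] n.
  assert (Ht1 : tau <= 1) by (eapply Rle_trans; [exact Ht|apply Rmin_l]).
  assert (Ht2 : C1 * tau ^ 2 <= 1).
  { assert (tau <= / (C1 + 1)) by (eapply Rle_trans; [exact Ht|apply Rmin_r]).
    assert (tau * (C1 + 1) <= 1).
    { apply Rmult_le_compat_r with (r := C1 + 1) in H; [|lra]. rewrite Rinv_l in H; lra. }
    nra. }
  (* Gronwall's majorant: [n] local errors of size [L tau^3], amplified by stability over the
     elapsed time. Using [n tau <= T] trades one power of [tau] for [T]. *)
  set (E := fun n => L * INR n * tau ^ 3 * exp (S * (INR n * tau))).
  assert (Ht3 : 0 < tau ^ 3) by now apply pow_lt.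
  assert (HE : forall n, INR n * tau <= T -> E n <= C1 * tau ^ 2).
  { intros m Hm. unfold E, C1. pose proof (pos_INR m).
    replace (L * INR m * tau ^ 3 * exp (S * (INR m * tau)))
      with (L * (INR m * tau) * exp (S * (INR m * tau)) * tau ^ 2) by ring.
    apply Rmult_le_compat_r; [apply pow2_ge_0|].
    assert (0 <= INR m * tau) by (apply Rmult_le_pos; lra).
    apply Rmult_le_compat.
    - now apply Rmult_le_pos.
    - left; apply exp_pos.
    - now apply Rmult_le_compat_l.
    - apply exp_le_exp. now apply Rmult_le_compat_l. }
  enough (Hmain : INR n * tau <= T -> Hb d g (Fsub (u (INR n * tau)) (numsol d tau u0 n)) (E n)).
  { intros Hn. eapply Hb_le; [apply HE, Hn|auto]. }
  induction n as [|n IH]; intros Hn.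
  - apply (Hb_ext d g _ (fun _ => 0%C)).
    + intros x Hx. unfold Fsub, numsol. simpl. rewrite Rmult_0_l.
      destruct (Hsol x Hx) as [-> _]. ring.
    + eapply Hb_le; [|apply Hb_0]. unfold E. simpl. right. ring.
  - rewrite S_INR in Hn. pose proof (pos_INR n).
    assert (Hn' : INR n * tau <= T) by nra.
    assert (H0 : 0 <= INR n * tau) by (apply Rmult_le_pos; lra).
    specialize (IH Hn').
    assert (Bu : Hb d g (u (INR n * tau)) M) by (apply Hb_mono, Hu; lra).
    assert (Bn : Hb d g (numsol d tau u0 n) A).
    { apply (Hb_ext d g _ (Fsub (u (INR n * tau)) (Fsub (u (INR n * tau)) (numsol d tau u0 n)))).
      - intros; unfold Fsub; ring.
      - eapply Hb_le; [|apply Hb_sub; [exact Bu|exact IH]]. specialize (HE n Hn'). unfold A. lra. }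
    assert (Bl := Hloc T (INR n * tau) u0 u tau Hsol Hu H0 Ht0 ltac:(lra)).
    assert (Bs := step_lip d g k tau _ _ A _ alg (conj Ht0 Ht1)
      (Hb_le _ _ _ M A ltac:(unfold A; lra) Bu) Bn IH).
    replace (INR (Datatypes.S n) * tau) with (INR n * tau + tau) by (rewrite S_INR; ring).
    change (numsol d tau u0 (Datatypes.S n)) with (step d tau (numsol d tau u0 n)).
    eapply Hb_le; [|eapply Hb_sub_trans; [exact Bl|exact Bs]].
    fold S. unfold E. rewrite S_INR.
    replace (S * ((INR n + 1) * tau)) with (S * tau + S * (INR n * tau)) by ring.
    rewrite exp_plus.
    pose proof (one_plus_le_exp (S * tau)) as H1.
    assert (H2 : 1 <= exp (S * (INR n * tau))).
    { rewrite <- exp_0. apply exp_le_exp. now apply Rmult_le_pos. }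
    assert (H3 : 0 <= S * tau) by (apply Rmult_le_pos; lra).
    set (e1 := exp (S * tau)) in *. set (e2 := exp (S * (INR n * tau))) in *.
    (* The recursion closes in two pieces: the new local error is absorbed because both exponentials
       are at least 1, and the propagated error because [1 + S tau <= e^(S tau)]. *)
    assert (H4 : L * tau ^ 3 * 1 <= L * tau ^ 3 * (e1 * e2)).
    { apply Rmult_le_compat_l; [apply Rmult_le_pos; lra|]. nra. }
    assert (H5 : (1 + tau * S) * (L * INR n * tau ^ 3 * e2) <= e1 * (L * INR n * tau ^ 3 * e2)).
    { apply Rmult_le_compat_r; [|lra].
      apply Rmult_le_pos; [|lra]. apply Rmult_le_pos; [|lra]. now apply Rmult_le_pos. }
    lra.
Qed.

Theorem theorem1p1 :
  forall (d : nat) (T gamma M : R),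
    (1 <= d)%nat -> 0 < T -> INR d / 2 < gamma ->
    exists tau0 C0 : R, 0 < tau0 /\ 0 < C0 /\
      forall (u0 : Four) (u : R -> Four),
        nls_solution d T u0 u ->
        (forall t, 0 <= t <= T -> Rbar_le (Hnorm d (gamma + 2) (u t)) (Finite M)) ->
        forall tau : R, 0 < tau <= tau0 ->
        forall n : nat, INR n * tau <= T ->
          Rbar_le (Hnorm d gamma (Fsub (u (INR n * tau)) (numsol d tau u0 n)))
                  (Finite (C0 * tau ^ 2)).
Proof.
  intros d T gamma M Hd HT Hg.
  destruct (algebra_exists d gamma Hd Hg) as [k1 H1].
  destruct (algebra_exists d (gamma + 2) Hd ltac:(lra)) as [k2 H2].
  assert (HP : 0 < sqrt ((2 * PI) ^ d)).
  { apply sqrt_lt_R0, pow_lt. pose proof PI_RGT_0; lra. }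
  destruct (global_error d gamma (Rmax k1 k2) (Rabs M / sqrt ((2 * PI) ^ d)) T
    (H1 _ (Rmax_l _ _)) (H2 _ (Rmax_r _ _))) as [tau0 [C1 [Ht0 [HC1 H]]]];
    [apply Rdiv_le_0_compat; [apply Rabs_pos|assumption]|assumption|].
  (* The square root restores the normalisation of [Hnorm]; the [+ 1] gives strict positivity, as
     [C1] may vanish. *)
  exists tau0, (sqrt ((2 * PI) ^ d) * C1 + 1).
  assert (0 <= sqrt ((2 * PI) ^ d) * C1) by (apply Rmult_le_pos; lra).
  split; [assumption|split; [lra|]].
  intros u0 u Hsol Hu tau Htau n Hn.
  eapply Rbar_le_trans.
  - apply Hb_Hnorm_le. apply (H u0 u Hsol); try assumption.
    intros r Hr. now apply Hnorm_le_Hb, Hu.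
  - simpl. pose proof (pow2_ge_0 tau). simpl in *. nra.
Qed.
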